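(* A max-stable random sup-measure $X$ on $E$ is a Choquet random sup-measure (CRSM) if and only if its tail dependence functional is the Choquet integral with respect to its extremal coefficient functional: $$\ell(f)=\int f\,d\theta=\int_0^\infty\theta(\{f\ge t\})\,dt\qquad\text{for all } f\in\mathrm{USC}.$$ In particular, the distribution of a CRSM is uniquely determined by its extremal coefficient functional $\theta$.
   Context: $E$ is a locally compact Hausdorff second countable space; $\mathcal K$ its compact subsets. A sup-measure on $E$ is a Choquet capacity $\varphi$ (non-decreasing, $\varphi(\emptyset)=0$, $\varphi(A_n)\uparrow\varphi(A)$ if $A_n\uparrow A$, $\varphi(K_n)\downarrow\varphi(K)$ for compact $K_n\downarrow K$), finite on compacts, with $\varphi(\bigcup_j G_j)=\sup_j\varphi(G_j)$ for all families of open sets; a random sup-measure is a random element of the space of sup-measures (Borel $\sigma$-algebra of the sup-vague topology). $\mathrm{USC}$: bounded non-negative upper semicontinuous functions on $E$ with relatively compact support. Extremal integral $\int^e f\,d\varphi=\sup\{\varphi(K)\inf_{x\in K}f(x):K\in\mathcal K\}$. Unit Fréchet with scale $a\ge0$: distribution function $\exp(-a/t)$, $t>0$. $X$ is max-stable if $\bigvee_iu_iX(K_i)$ is unit Fréchet for all $K_i\in\mathcal K$, $u_i\ge0$; tail dependence functional $\ell(f)$ = scale parameter of $\int^e f\,dX$; extremal coefficient functional $\theta(K)=\ell(\mathbf 1_K)$. Functions $f,g$ are comonotonic if $(f(x)-f(y))(g(x)-g(y))\ge0$ for all $x,y\in E$. A max-stable random sup-measure is a Choquet random sup-measure (CRSM)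 if $\ell(f+g)=\ell(f)+\ell(g)$ for all comonotonic $f,g\in\mathrm{USC}$. *)

(* Defs.v *)
From HB Require Import structures.
From mathcomp Require Import all_boot all_order all_algebra.
From mathcomp Require Import all_classical all_reals all_analysis.
Set Implicit Arguments. Unset Strict Implicit. Unset Printing Implicit Defensive.
Import Order.TTheory GRing.Theory Num.Theory.
Import numFieldNormedType.Exports.
Local Open Scope classical_set_scope.
Local Open Scope ring_scope.
Local Open Scope ereal_scope.

Section Defs.
Context {R : realType} {E : topologicalType}.

Definition supmeasure (phi : set E -> \bar R) : Prop :=
  [/\ (forall A B, A `<=` B -> phi A <= phi B),
      phi set0 = 0 &
  [/\
      (forall A : nat -> set E, (forall n, A n `<=` A n.+1) ->
          (fun n => phi (A n)) @ \oo --> phi (\bigcup_n A n)),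
      (forall K : nat -> set E, (forall n, compact (K n)) ->
          (forall n, K n.+1 `<=` K n) ->
          (fun n => phi (K n)) @ \oo --> phi (\bigcap_n K n)),
      (forall K, compact K -> phi K < +oo) &
      (forall F : set (set E), F !=set0 -> (forall G, F G -> open G) ->
          phi (\bigcup_(G in F) G) = ereal_sup [set phi G | G in F])]].

Definition SM : set (set E -> \bar R) := supmeasure.

Definition supvague_subbase (U : set (set E -> \bar R)) : Prop :=
  (exists K (x : R), compact K /\ U = [set phi | SM phi /\ phi K < x%:E]) \/
  (exists G (x : R), open G /\ U = [set phi | SM phi /\ x%:E < phi G]).

Definition supvague_open (U : set (set E -> \bar R)) : Prop :=
  U `<=` SM /\
  forall phi, U phi -> exists (n : nat) (B : nat -> set (set E -> \bar R)),
    (forall i, (i < n)%N -> supvague_subbase (B i)) /\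
    phi \in SM `&` \bigcap_(i in [set i | (i < n)%N]) B i /\
    SM `&` \bigcap_(i in [set i | (i < n)%N]) B i `<=` U.

Definition supvague_borel : set (set (set E -> \bar R)) :=
  <<s SM, supvague_open >>.

Definition random_supmeasure {d} {Omega : measurableType d}
    (X : Omega -> set E -> \bar R) : Prop :=
  (forall w, SM (X w)) /\
  (forall A, supvague_borel A -> measurable (X @^-1` A)).

Definition frechet_scale {d} {Omega : measurableType d}
    (P : probability Omega R) (xi : Omega -> \bar R) (a : R) : Prop :=
  (0 <= a)%R /\ forall t : R, (0 < t)%R ->
    P [set w | xi w <= t%:E] = (expR (- (a / t)))%:E.

Definition max_stable {d} {Omega : measurableType d}
    (P : probability Omega R) (X : Omega -> set E -> \bar R) : Prop :=
  random_supmeasure X /\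
  forall (n : nat) (K : nat -> set E) (u : nat -> R),
    (forall i, compact (K i)) -> (forall i, (0 <= u i)%R) ->
    exists a, frechet_scale P
      (fun w => \big[maxe/0]_(i < n) ((u i)%:E * X w (K i))) a.

Definition USC (f : E -> R) : Prop :=
  [/\ (forall x, (0 <= f x)%R),
      (exists M : R, forall x, (f x <= M)%R),
      (forall t : R, closed [set x | (t <= f x)%R]) &
      compact (closure [set x | (0 < f x)%R])].

Definition extremal_integral (f : E -> R) (phi : set E -> \bar R) : \bar R :=
  ereal_sup [set phi K * ereal_inf [set (f x)%:E | x in K] | K in compact].

Definition tdf {d} {Omega : measurableType d}
    (P : probability Omega R) (X : Omega -> set E -> \bar R) (f : E -> R) : R :=
  xget 0%R [set a | frechet_scale P (fun w => extremal_integral f (X w)) a].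

Definition ecf {d} {Omega : measurableType d}
    (P : probability Omega R) (X : Omega -> set E -> \bar R) (A : set E) : R :=
  tdf P X (\1_A).

Definition comonotonic (f g : E -> R) : Prop :=
  forall x y, (0 <= (f x - f y) * (g x - g y))%R.

Definition CRSM {d} {Omega : measurableType d}
    (P : probability Omega R) (X : Omega -> set E -> \bar R) : Prop :=
  max_stable P X /\
  forall f g, USC f -> USC g -> comonotonic f g ->
    tdf P X (f \+ g)%R = (tdf P X f + tdf P X g)%R.

Definition choquet_integral (theta : set E -> R) (f : E -> R) : \bar R :=
  \int[@lebesgue_measure R]_(t in `]0%R, +oo[%classic)
     (theta [set x | (t <= f x)%R])%:E.

End Defs.

(* Main.v *)
Require Import Defs.
From HB Require Import structures.
From mathcomp Require Import all_boot all_order all_algebra.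
From mathcomp Require Import all_classical all_reals all_analysis.
From mathcomp Require Import measurable_realfun zify lra.
Import Order.TTheory GRing.Theory Num.Theory.
Import numFieldNormedType.Exports.
Local Open Scope classical_set_scope.
Local Open Scope ring_scope.
Set Implicit Arguments.
Unset Strict Implicit.
Unset Printing Implicit Defensive.

(** For [f] in USC one has [extremal_integral f phi = sup_s s * phi {f >= s}], a
    countable supremum, so the extremal integral of a max-stable random
    sup-measure is a monotone limit of finite maxima and has a Frechet scale.

    Rounding [f] down to multiples of a mesh [c] gives a staircase, a sum of the
    comonotone functions [c 1_{f >= ck}]; comonotonic additivity turns its tail
    dependence into the Riemann sum [c * sum_k theta {f >= ck}], and both
    [tdf f] and the Choquet integral are within [c * theta (supp f)] of it.
    Conversely, the level sets of two comonotone staircases are nested, so the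
    Riemann sum of their sum splits.

    The law is determined by the probabilities of [X K_i <= x_i, i < n]. Since
    sup-measures are finitely maxitive on compact sets, this event says that the
    extremal integral of [max_i 1_{K_i} / x_i] is at most 1. *)

(** * A countable system of neighbourhoods for compact sets *)

Section countable_neighbourhoods.
Context {E : topologicalType}.
Hypotheses (E_lc : locally_compact [set: E]) (E_T2 : hausdorff_space E).
Hypothesis E_2c : @second_countable E.

(** Such a sequence squeezes a relatively compact open set between any compact set and any open set
    around it. All later reductions to countably many sets go through it. *)
Definition compact_neighbourhoods (U : nat -> set E) : Prop :=
  [/\ forall n, open (U n), forall n, compact (closure (U n)) &
    forall K G, compact K -> open G -> K `<=` G ->
      exists2 n, K `<=` U n & closure (U n) `<=` G].

Lemma closure_nbhs_sub (x : E) (G : set E) : nbhs x G ->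
  exists2 V, nbhs x V & closure V `<=` G /\ compact (closure V).
Proof.
move=> Gx; have := @E_lc x I; rewrite withinET => -[C Cx [cC clC]].
have [V Vx VG] := compact_regular E_T2 cC Cx (filterI Gx Cx).
exists V => //; split; first by move=> y /VG[].
by apply: (subclosed_compact _ cC); [exact: closed_closure|move=> y /VG[]].
Qed.

(** The members of a countable base with compact closure still form a base, because every point has
    small neighbourhoods with compact closure. *)
Lemma exists_countable_base : exists e : nat -> set E,
  [/\ forall n, open (e n), forall n, compact (closure (e n)) &
    forall x G, nbhs x G -> exists n, e n x /\ closure (e n) `<=` G].
Proof.
case: E_2c => B /countable_injP[f finj] [oB bB].
pose good b := B b /\ compact (closure b).
(* As [f] is injective on [B], this union has at most one member: [e n] is the good set coded by
   [n], or empty. *)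
pose e n := \bigcup_(b in [set b | good b /\ f b = n]) b.
have ef b : good b -> e (f b) = b.
  move=> gb; apply/seteqP; split => [x [c [[Bc cc]] /finj]|x bx].
    by rewrite !inE => ->//; case: gb.
  by exists b.
have eP n : e n = set0 \/ exists2 b, good b & e n = b.
  have [->|/set0P[x [b [gb <-] bx]]] := eqVneq (e n) set0; first by left.
  by right; exists b => //; rewrite ef.
exists e; split => [n|n|x G Gx].
- by case: (eP n) => [->|[b [/oB ob _] ->]//]; exact: open0.
- by case: (eP n) => [->|[b [_ cb] ->]//]; rewrite closure0; exact: compact0.
- have [V Vx [VG cV]] := closure_nbhs_sub Gx.
  have [b [Bb bx] bV] := bB x V Vx.
  have gb : good b.
    split => //; apply: (subclosed_compact _ cV); first exact: closed_closure.
    exact: closureS.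
  exists (f b); rewrite ef//; split => //.
  by apply: subset_trans VG; exact: closureS.
Qed.

(** Finite unions of base sets do the job. They are indexed by lists of naturals, hence by naturals
    through [pickle]. *)
Lemma exists_compact_neighbourhoods : exists U, compact_neighbourhoods U.
Proof.
have [e [oe ce eP]] := exists_countable_base.
pose W s := \big[setU/set0]_(k <- s) e k.
have WP s x : W s x <-> exists2 k, k \in s & e k x.
  rewrite /W -bigcup_seq; split => [[k ks ekx]|[k ks ekx]]; by exists k.
have clW s : closure (W s) = \big[setU/set0]_(k <- s) closure (e k).
  rewrite /W; elim: s => [|k s IH]; first by rewrite !big_nil closure0.
  by rewrite !big_cons closureU IH.
exists (fun n => if unpickle n is Some s then W s else set0); split.
- move=> n; case: unpickle => [s|]; last exact: open0.
  by rewrite /W -bigcup_seq; apply: bigcup_open.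
- move=> n; case: unpickle => [s|]; last by rewrite closure0; exact: compact0.
  by rewrite clW; apply: bigsetU_compact.
move=> K G cK oG KG.
pose ok k := closure (e k) `<=` G.
(* The lists of admissible indices, directed by inclusion. Compactness in near-covering form turns
   one index per point into one list for all of [K]. *)
pose F : set_system (seq nat) := filter_from [set s : seq nat | {in s, forall k, ok k}]
  (fun s : seq nat => [set t : seq nat | {in t, forall k, ok k} /\ {subset s <= t}]).
have FF : Filter F.
  apply: filter_from_filter; first by exists [::].
  move=> s t /= oks okt; exists (s ++ t) => [k|u [oku ut]].
    by rewrite mem_cat => /orP[/oks|/okt].
  by split; split => // k ks; apply: ut; rewrite mem_cat ks ?orbT.
have [|s oks sK] := (compact_near_coveringP K).1 cK _ F (fun s x => W s x) FF.
  move=> x Kx; have [k [ekx ekG]] := eP x G (open_nbhs_nbhs (conj oG (KG _ Kx))).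
  exists (e k, [set t : seq nat | {in t, forall k, ok k} /\ {subset [:: k] <= t}]).
    split => /=; first by apply: open_nbhs_nbhs; split.
    exists [:: k] => [j|//].
    by rewrite inE => /eqP ->.
  move=> [y t] /= [eky [_ kt]]; apply/WP; exists k => //.
  by apply: kt; rewrite inE.
exists (pickle s); rewrite pickleK; first by apply: sK; split.
by rewrite clW -bigcup_seq => x [k /oks okk]; exact: okk.
Qed.

End countable_neighbourhoods.

(** * Approximation and finite maxitivity of sup-measures *)

Section capacity.
Local Open Scope ereal_scope.
Context {R : realType} {E : topologicalType}.
Hypothesis E_T2 : hausdorff_space E.
Variables (U : nat -> set E) (phi : set E -> \bar R).
Hypotheses (UP : compact_neighbourhoods U) (SMphi : SM phi).

Lemma supmeasure_le (A B : set E) : A `<=` B -> phi A <= phi B.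
Proof. by case: SMphi => + _ _; apply. Qed.

Lemma supmeasure_ge0 (A : set E) : 0 <= phi A.
Proof. by case: SMphi => phile <- _; apply: phile. Qed.

Lemma supmeasure_fin_num (K : set E) : compact K -> phi K \is a fin_num.
Proof.
move=> cK; rewrite ge0_fin_numE; last exact: supmeasure_ge0.
by case: SMphi => _ _ [_ _ + _]; apply.
Qed.

(** The closures of the [U n] around [K] have intersections decreasing to [K], so continuity along
    decreasing compact sets applies. *)
Lemma supmeasure_outer (K : set E) (y : \bar R) : compact K -> phi K < y ->
  exists2 n, K `<=` U n & phi (closure (U n)) < y.
Proof.
case: UP => oU cU UKG cK Ky.
(* Sets that miss part of [K] are replaced by the whole space, which avoids extracting a
   subsequence. The intersections [C n] are compact from [n0] on. *)
pose V n := if `[< K `<=` U n >] then U n else setT.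
pose C n := \bigcap_(m in [set m | (m <= n)%N]) closure (V m).
have [n0 Kn0 _] := UKG K setT cK openT (@subsetT _ _).
have V0 : V n0 = U n0 by rewrite /V asboolT.
have KV n : K `<=` V n by rewrite /V; case: asboolP.
have cC n : (n0 <= n)%N -> compact (C n).
  move=> n0n; apply: (subclosed_compact _ (cU n0)).
    by apply: closed_bigI => m _; exact: closed_closure.
  by move=> x /(_ n0 n0n); rewrite V0.
have Cnd n : C n.+1 `<=` C n by move=> x Cx m mn; apply: Cx; exact: leqW.
have CK : \bigcap_n C (n0 + n)%N = K.
  apply/seteqP; split => x; last first.
    by move=> Kx n _ m _; apply: subset_closure; exact: KV.
  move=> Cx; apply: contrapT => nKx.
  (* A point outside [K] is excluded by some [U m] whose closure avoids it. *)
  have [||m Km mx] := UKG K (~` [set x]) cK.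
  - apply: closed_openC; apply: compact_closed => //; exact: compact_set1.
  - by move=> z Kz /= zx; apply: nKx; rewrite -zx.
  - have := Cx m I m (leq_addl _ _); rewrite /V asboolT// => /mx; exact.
case: (SMphi) => phile _ [_ phid _ _].
have := phid (fun n => C (n0 + n)%N) (fun n => cC _ (leq_addr _ _)).
rewrite CK => Ccvg; have {Ccvg} : (fun n => phi (C (n0 + n)%N)) @ \oo --> phi K.
  by apply: Ccvg => n; rewrite addnS; exact: Cnd.
move=> /(_ [set z | z < y]) [|N _ /(_ N (leqnn N)) /= CN].
  by apply: open_nbhs_nbhs; split => //; exact: open_ereal_lt_ereal.
(* This finite intersection is open, contains [K] and lies in [C (n0 + N)]. A single [U n] with
   closure inside it therefore inherits the bound. *)
pose G := \bigcap_(m in [set m | (m <= n0 + N)%N]) V m.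
have [||n Kn nG] := UKG K G cK.
- rewrite (_ : G = \big[setI/setT]_(m < (n0 + N).+1) V m).
    apply: big_ind => [||m _]; [exact: openT|exact: openI|].
    by rewrite /V; case: asboolP => _; [exact: oU|exact: openT].
  by rewrite -bigcap_mkord.
- by move=> x Kx m _; exact: KV.
exists n => //; apply: le_lt_trans CN; apply: phile => x /nG Gx m mN.
by apply: subset_closure; exact: Gx.
Qed.

(** [G] is the union of the [U n] whose closure it contains, and [phi] of a union of open sets is a
    supremum. *)
Lemma supmeasure_inner (G : set E) (y : \bar R) : open G -> y < phi G ->
  exists2 n, closure (U n) `<=` G & y < phi (U n).
Proof.
case: UP => oU cU UKG oG yG.
pose F := [set V | exists2 n, closure (U n) `<=` G & V = U n].
have FG : \bigcup_(V in F) V = G.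
  apply/seteqP; split => [x [_ [n nG ->] nx]|x Gx].
    by apply: nG; exact: subset_closure.
  have [|n xn nG] := UKG [set x] G (@compact_set1 _ x) oG; first by move=> _ ->.
  by exists (U n); [exists n|exact: xn].
case: (SMphi) => _ _ [_ _ _ phisup].
have := phisup F; rewrite FG => phiG.
move: yG; rewrite phiG; last 2 first.
- by have [n _ nG] := UKG set0 G (@compact0 _) oG (@sub0set _ _); exists (U n), n.
- by move=> _ [n _ ->].
by move=> /ereal_sup_gt[_ [_ [n nG ->] <-] yn]; exists n.
Qed.

Lemma supmeasureU_open (G H : set E) (y : \bar R) : open G -> open H ->
  phi G <= y -> phi H <= y -> phi (G `|` H) <= y.
Proof.
move=> oG oH Gy Hy; case: (SMphi) => _ _ [_ _ _ phisup].
have -> : G `|` H = \bigcup_(V in [set G; H]) V by rewrite bigcup_setU1 bigcup_set1.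
rewrite phisup; first by apply: ge_ereal_sup => _ [_ [->|->] <-].
- by exists G; left.
- by move=> _ [->|->].
Qed.

(** The supremum axiom speaks of open sets only, so both compact sets are first enlarged to open
    ones at a cost [e]. *)
Lemma supmeasureU_compact (K L : set E) (y : R) : compact K -> compact L ->
  phi K <= y%:E -> phi L <= y%:E -> phi (K `|` L) <= y%:E.
Proof.
move=> cK cL Ky Ly; apply/lee_addgt0Pr => e e0.
have ye : y%:E < y%:E + e%:E by rewrite -EFinD lte_fin ltrDl.
have [n Kn ny] := supmeasure_outer cK (le_lt_trans Ky ye).
have [m Lm my] := supmeasure_outer cL (le_lt_trans Ly ye).
apply: (@le_trans _ _ (phi (U n `|` U m))).
  by apply: supmeasure_le; exact: setUSS.
case: UP => oU _ _; apply: supmeasureU_open => //.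
  by apply: le_trans (ltW ny); apply: supmeasure_le; exact: subset_closure.
by apply: le_trans (ltW my); apply: supmeasure_le; exact: subset_closure.
Qed.

Lemma supmeasure_bigcup_compact (I : Type) (s : seq I) (Q : pred I)
    (K : I -> set E) (y : R) : (0 <= y)%R ->
  (forall i, Q i -> compact (K i)) -> (forall i, Q i -> phi (K i) <= y%:E) ->
  phi (\big[setU/set0]_(i <- s | Q i) K i) <= y%:E.
Proof.
move=> y0 cK Ky; elim: s => [|i s IH].
  by rewrite big_nil; case: SMphi => _ -> _; rewrite lee_fin.
rewrite big_cons; case: ifPn => // Qi; apply: supmeasureU_compact => //.
- exact: cK.
- by apply: bigsetU_compact.
- exact: Ky.
Qed.

End capacity.

(** * Upper semicontinuous functions and their level sets *)

Section USC_theory.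
Context {R : realType} {E : topologicalType}.
Implicit Types f g : E -> R.

(* The condition 0 < s makes this set compact for every real s when f is USC. *)
Definition level f (s : R) : set E := [set x | 0 < s /\ s <= f x].

Lemma level_gt0 f s : 0 < s -> level f s = [set x | s <= f x].
Proof. by move=> s0; apply/seteqP; split => [x []|x]. Qed.

Lemma compact_level f s : USC f -> compact (level f s).
Proof.
move=> [f0 fM fc cf]; have [s0|s0] := ltP 0 s; last first.
  rewrite (_ : level f s = set0); first exact: compact0.
  by apply/seteqP; split => x // -[]; rewrite ltNge s0.
rewrite level_gt0//; apply: (subclosed_compact (fc s) cf) => x /= sx.
by apply: subset_closure => /=; exact: lt_le_trans sx.
Qed.

Lemma USC_indic (c : R) (A : set E) : hausdorff_space E -> 0 <= c ->
  compact A -> USC (fun x => c * \1_A x).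
Proof.
move=> hE c0 cA; have clA : closed A := compact_closed hE cA.
have E1 x : A x -> c * \1_A x = c by move=> Ax; rewrite indicE mem_set// mulr1.
have E0 x : ~ A x -> c * \1_A x = 0 by move=> Ax; rewrite indicE memNset// mulr0.
split.
- by move=> x; case: (pselect (A x)) => [/E1|/E0] ->.
- by exists c => x; case: (pselect (A x)) => [/E1|/E0] ->.
- move=> t; have [t0|t0] := leP t 0.
    rewrite (_ : [set x | _] = setT); first exact: closedT.
    apply/seteqP; split => // x _ /=; apply: le_trans t0 _.
    by case: (pselect (A x)) => [/E1|/E0] ->.
  have [tc|ct] := leP t c.
    rewrite (_ : [set x | _] = A)//; apply/seteqP; split => x /=.
      by apply: contraPP => /E0 ->; rewrite leNgt t0.
    by move=> /E1 ->.
  rewrite (_ : [set x | _] = set0); first exact: closed0.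
  apply/seteqP; split => // x /=; case: (pselect (A x)) => [/E1|/E0] ->.
    by rewrite leNgt ct.
  by rewrite leNgt t0.
- apply: (subclosed_compact _ cA); first exact: closed_closure.
  rewrite [X in _ `<=` X](closure_id A).1//; apply: closureS => x /=.
  by apply: contraPP => /E0 ->; rewrite ltxx.
Qed.

Lemma USCD f g : USC f -> USC g -> USC (f \+ g).
Proof.
move=> [f0 [M fM] fc cf] [g0 [N gN] gc cg]; split.
- by move=> x /=; apply: addr_ge0.
- by exists (M + N) => x /=; apply: lerD.
- move=> t; rewrite -openC (_ : ~` _ = \bigcup_(q in setT)
    (~` [set x | q <= f x] `&` ~` [set x | t - q <= g x])).
    by apply: bigcup_open => q _; apply: openI; rewrite openC.
  apply/seteqP; split => x /=.
    (* Half of the slack [t - (f x + g x)] is given to [f] and half to [g]. *)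
    move=> /negP; rewrite -ltNge => fgt; exists (f x + (t - (f x + g x)) / 2) => //.
    by split => /=; apply/negP; rewrite -ltNge; lra.
  by move=> [q _ [/= /negP + /negP]]; rewrite -!ltNge => ? ?; apply/negP; lra.
- apply: (subclosed_compact _ (compactU cf cg)); first exact: closed_closure.
  rewrite -closureU; apply: closureS => x /= fg.
  have := f0 x; rewrite le_eqVlt => /orP[/eqP fx0|]; last by left.
  by right; move: fg; rewrite -fx0 add0r.
Qed.

Lemma USCZ (c : R) f : 0 < c -> USC f -> USC (fun x => c * f x).
Proof.
move=> c0 [f0 [M fM] fc cf]; split.
- by move=> x; rewrite mulr_ge0// ltW.
- by exists (c * M) => x; rewrite ler_pM2l.
- by move=> t; under eq_set do rewrite mulrC -ler_pdivrMr//; exact: fc.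
- by under eq_set do rewrite pmulr_rgt0//.
Qed.

Lemma exists_dense_nneg : exists r : nat -> R, (forall n, 0 <= r n) /\
  forall a b, 0 <= a -> a < b -> exists n, a < r n < b.
Proof.
exists (fun n => if unpickle n is Some q then Num.max 0 (ratr q : R) else 0).
split => [n|a b a0 ab]; first by case: unpickle => // q; rewrite le_max lexx.
have [q] := rat_in_itvoo ab; rewrite in_itv/= => /andP[aq qb].
exists (pickle q); rewrite pickleK max_r ?aq//.
by rewrite ltW// (le_lt_trans a0).
Qed.

End USC_theory.

(** * The extremal integral through level sets *)

Section extremal_integral_theory.
Local Open Scope ereal_scope.
Context {R : realType} {E : topologicalType}.
Variables (phi : set E -> \bar R).
Hypothesis SMphi : SM phi.
Implicit Types f g : E -> R.

(** A compact [K] on which [f] has infimum [c > 0] lies in the level set of [f] at [c], so only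
    level sets compete in the supremum. *)
Lemma extremal_integral_le f t : USC f -> (0 <= t)%R ->
  extremal_integral f phi <= t%:E <->
  forall s : R, s%:E * phi (level f s) <= t%:E.
Proof.
move=> Uf t0; have f0 : forall x, (0 <= f x)%R by case: Uf.
have phi0 : phi set0 = 0 by case: SMphi.
have phige0 := supmeasure_ge0 SMphi.
have phiN0 (A : set E) : phi A != 0 -> A !=set0.
  by move=> pA; apply/set0P; apply: contra_neq pA => ->.
split=> [EIt s|lt].
  apply: le_trans EIt; have cl := @compact_level _ _ f s Uf.
  apply: (@le_trans _ _ (phi (level f s) *
      ereal_inf [set (f x)%:E | x in level f s])).
    rewrite muleC lee_wpmul2l//; apply: le_ereal_inf_tmp => _ [x [_ sx] <-].
    by rewrite lee_fin.
  by apply: ereal_sup_ubound; exists (level f s).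
apply: ge_ereal_sup => _ [K cK <-].
(* The case [phi K = 0] includes the empty [K], whose infimum is [+oo]; in the other case the
   infimum is finite. *)
have [->|/phiN0[x0 Kx0]] := eqVneq (phi K) 0; first by rewrite mul0e lee_fin.
have inf0 : 0 <= ereal_inf [set (f x)%:E | x in K].
  by apply: le_ereal_inf_tmp => _ [x _ <-]; rewrite lee_fin.
have infK x : K x -> ereal_inf [set (f x)%:E | x in K] <= (f x)%:E.
  by move=> Kx; apply: ereal_inf_lbound; exists x.
have : ereal_inf [set (f x)%:E | x in K] \is a fin_num.
  by rewrite ge0_fin_numE// (le_lt_trans (infK _ Kx0))// ltry.
move=> /fineK; set c := fine _ => cE; rewrite -cE muleC.
rewrite -cE lee_fin in inf0.
have [c0|c0] := leP c 0%R.
  by rewrite (_ : c = 0%R) ?mul0e ?lee_fin//; apply/eqP; rewrite eq_le c0 inf0.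
apply: le_trans (lt c); rewrite lee_wpmul2l// ?lee_fin ?(ltW c0)//.
apply: supmeasure_le => // x Kx; split => //.
by have := infK x Kx; rewrite -cE lee_fin.
Qed.

(** Some [r n] lies just below [s] and has a larger level set, so replacing [s] by [r n] costs at
    most [(s - r n) * phi (level f s)]. *)
Lemma extremal_integral_le_dense (r : nat -> R) f t :
  (forall a b, (0 <= a -> a < b -> exists n, a < r n < b)%R) ->
  USC f -> (0 <= t)%R ->
  extremal_integral f phi <= t%:E <->
  forall n, (r n)%:E * phi (level f (r n)) <= t%:E.
Proof.
move=> rd Uf t0; rewrite extremal_integral_le//; split => // rt s.
have [s0|s0] := leP s 0%R.
  apply: (@le_trans _ _ 0); last by rewrite lee_fin.
  by rewrite mule_le0_ge0 ?lee_fin//; exact: supmeasure_ge0.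
have /fineK pE := supmeasure_fin_num SMphi (@compact_level _ _ f s Uf).
have p0 : (0 <= fine (phi (level f s)))%R.
  by rewrite fine_ge0//; exact: supmeasure_ge0.
rewrite -pE -EFinM lee_fin; apply/ler_addgt0Pr => e e0.
set p := fine _ in pE p0 *.
(* A gap of this size times [p] is at most [e]; adding 1 covers [p = 0]. *)
have d0 : (0 < e / (p + 1))%R by rewrite divr_gt0// ltr_wpDl.
have [] := rd (Num.max 0 (s - e / (p + 1)))%R s.
- by rewrite le_max lexx.
- by rewrite gt_max s0/= ltrBlDr ltrDl.
move=> n /andP[]; rewrite gt_max => /andP[rn0 srn] rns.
have : (r n * p <= t)%R.
  rewrite -lee_fin EFinM pE; apply: le_trans (rt n).
  rewrite lee_wpmul2l ?lee_fin ?(ltW rn0)//; apply: supmeasure_le => //.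
  by move=> x [_ sx]; split => //; exact: le_trans (ltW rns) sx.
move=> rnt; apply: (@le_trans _ _ ((r n + e / (p + 1)) * p))%R.
  by rewrite ler_wpM2r//; rewrite ltrBlDr in srn; exact: ltW.
rewrite mulrDl lerD// -mulrA ler_piMr ?(ltW e0)//.
by rewrite mulrC ler_pdivrMr ?mul1r ?lerDl// ltr_wpDl.
Qed.

Lemma extremal_integral_mono f g : (forall x, f x <= g x)%R ->
  (forall x, 0 <= f x)%R ->
  extremal_integral f phi <= extremal_integral g phi.
Proof.
move=> fg f0; apply: ge_ereal_sup => _ [K cK <-].
apply: (@le_trans _ _ (phi K * ereal_inf [set (g x)%:E | x in K])).
  rewrite lee_wpmul2l ?(supmeasure_ge0 SMphi)//.
  apply: le_ereal_inf_tmp => _ [x Kx <-]; apply: (@le_trans _ _ (f x)%:E).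
    by apply: ereal_inf_lbound; exists x.
  by rewrite lee_fin.
by apply: ereal_sup_ubound; exists K.
Qed.

End extremal_integral_theory.

(** * Fréchet scales: order, uniqueness and monotone limits *)

Section frechet.
Local Open Scope ereal_scope.
Context {R : realType} {d : measure_display} {Omega : measurableType d}.
Variable P : probability Omega R.
Implicit Types xi eta : Omega -> \bar R.

Lemma frechet_scale_le xi eta a b :
  (forall t : R, (0 < t)%R -> measurable [set w | xi w <= t%:E]) ->
  (forall t : R, (0 < t)%R -> measurable [set w | eta w <= t%:E]) ->
  (forall w, xi w <= eta w) ->
  frechet_scale P xi a -> frechet_scale P eta b -> (a <= b)%R.
Proof.
move=> mxi meta xieta [_ xia] [_ etab].
have : P [set w | eta w <= 1%:E] <= P [set w | xi w <= 1%:E].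
  apply: le_measure; rewrite ?inE; [exact: meta|exact: mxi|].
  by move=> w /=; exact: le_trans.
by rewrite xia// etab// lee_fin ler_expR lerN2 !divr1.
Qed.

Lemma frechet_scale_uniq xi a b :
  frechet_scale P xi a -> frechet_scale P xi b -> a = b.
Proof.
move=> [_ xia] [_ xib]; have := xia _ (@ltr01 R); rewrite xib// => -[] /expR_inj.
by rewrite !divr1 => /oppr_inj.
Qed.

(** The event [xi <= t] is the decreasing intersection of the events [eta n <= t]. Continuity from
    above and continuity of [expR] give the scale [limn a], which is finite thanks to the bound
    [A]. *)
Lemma frechet_scale_sup xi (eta : nat -> Omega -> \bar R) (a : nat -> R) (A : R) :
  (forall n (t : R), (0 < t)%R -> measurable [set w | eta n w <= t%:E]) ->
  (forall n w, eta n w <= eta n.+1 w) ->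
  (forall n, frechet_scale P (eta n) (a n)) -> (forall n, (a n <= A)%R) ->
  (forall w (t : R), (0 < t)%R ->
    xi w <= t%:E <-> forall n, eta n w <= t%:E) ->
  exists b, frechet_scale P xi b.
Proof.
move=> meta etaS etaa aA xieta.
have nda : nondecreasing_seq a.
  by apply/nondecreasing_seqP => n;
    exact: frechet_scale_le (meta n) (meta n.+1) (etaS n) (etaa n) (etaa n.+1).
have cva : a @ \oo --> limn a.
  by apply: nondecreasing_is_cvgn => //; exists A => _ [n _ <-].
exists (limn a); split.
  apply: limr_ge; first exact: cva.
  by apply: nearW => n; case: (etaa n).
move=> t t0; rewrite (_ : [set w | xi w <= t%:E] =
    \bigcap_n [set w | eta n w <= t%:E]); last first.
  by apply/seteqP; split => [w /xieta + n _|w wn]; [apply|apply/xieta => // n; apply: wn].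
have cvP : P \o (fun n => [set w | eta n w <= t%:E]) @ \oo -->
    P (\bigcap_n [set w | eta n w <= t%:E]).
  apply: nonincreasing_cvg_mu.
  - by rewrite (le_lt_trans (probability_le1 _ _))// ?ltry//; exact: meta.
  - by move=> n; exact: meta.
  - by apply: bigcapT_measurable => n; exact: meta.
  - apply/nonincreasing_seqP => n; apply/subsetPset => w /=.
    exact: le_trans.
apply: (cvg_unique _ cvP); first exact: ereal_hausdorff.
rewrite (_ : _ \o _ = EFin \o (fun n => expR (- (a n / t)))); last first.
  by apply/funext => n /=; case: (etaa n) => _ ->.
apply: cvg_EFin; first exact: nearW.
apply: (@cvg_comp _ _ _ (fun n => - (a n / t))%R expR _ (nbhs (- (limn a / t))%R)).
  by apply: cvgN; apply: cvgMr_tmp.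
exact: continuous_expR.
Qed.

End frechet.

(** * The tail dependence functional of a max-stable random sup-measure *)

Section max_stable_theory.
Local Open Scope ereal_scope.
Context {R : realType} {E : topologicalType}.
Context {d : measure_display} {Omega : measurableType d}.
Variables (P : probability Omega R) (X : Omega -> set E -> \bar R).
Hypotheses (E_T2 : hausdorff_space E) (msX : max_stable P X).
Implicit Types f g : E -> R.

Lemma max_stable_SM w : SM (X w). Proof. by case: msX => -[]. Qed.

Lemma measurable_X (K : set E) : compact K -> measurable_fun setT (X ^~ K).
Proof.
move=> cK; apply: (measurability _ (ErealGenInftyO.measurableE R)).
move=> _ [_ [r ->] <-]; case: msX => -[SMX mX] _.
rewrite setTI (_ : _ @^-1` _ = X @^-1` [set phi | SM phi /\ phi K < r%:E]).
  apply: mX; apply: sub_sigma_algebra; split => [phi []//|phi [SMphi phir]].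
  exists 1%N, (fun=> [set phi | SM phi /\ phi K < r%:E]); split.
    by move=> i _; left; exists K, r.
  split; first by rewrite inE; split => // i _.
  by move=> psi [_ /(_ 0%N)]; apply.
apply/seteqP; split => w /=; rewrite in_itv//=.
by case.
Qed.

Definition max_scaled (n : nat) (K : nat -> set E) (u : nat -> R) w : \bar R :=
  \big[maxe/0]_(i < n) ((u i)%:E * X w (K i)).

Lemma max_scaled_le n K u w (t : R) : (0 <= t)%R ->
  max_scaled n K u w <= t%:E <->
  forall i, (i < n)%N -> (u i)%:E * X w (K i) <= t%:E.
Proof.
move=> t0; split => [/bigmax_leP[_ le] i ni|le]; first exact: (le (Ordinal ni)).
by apply/bigmax_leP; split => // i _; exact: le.
Qed.

Lemma measurable_max_scaled n K u (t : R) : (forall i, compact (K i)) ->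
  (0 <= t)%R -> measurable [set w | max_scaled n K u w <= t%:E].
Proof.
move=> cK t0; rewrite (_ : [set w | _] = \bigcap_(i in [set i | (i < n)%N])
    [set w | (u i)%:E * X w (K i) <= t%:E]); last first.
  by apply/seteqP; split => w /=; move=> /(max_scaled_le _ _ _ _ t0).
apply: bigcap_measurableType => i _.
rewrite -[X in measurable X]setTI; apply: emeasurable_fun_infty_c => //.
by apply: measurable_funeM; exact: measurable_X.
Qed.

Let r := sval (cid (@exists_dense_nneg R)).
Let r0 n : (0 <= r n)%R. Proof. exact: (svalP (cid (@exists_dense_nneg R))).1. Qed.
Let rd a b : (0 <= a -> a < b -> exists n, a < r n < b)%R.
Proof. exact: (svalP (cid (@exists_dense_nneg R))).2. Qed.
Let lev f n := level f (r n).

Let EI_max_scaled f w (t : R) : USC f -> (0 < t)%R ->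
  extremal_integral f (X w) <= t%:E <-> forall n, max_scaled n (lev f) r w <= t%:E.
Proof.
move=> Uf t0; have t0' := ltW t0.
rewrite (extremal_integral_le_dense (max_stable_SM w) rd Uf t0').
split => [le n|le n]; first by apply/max_scaled_le => // i _; exact: le.
by have /max_scaled_le := le n.+1; apply.
Qed.

Lemma measurable_extremal_integral f (t : R) : USC f -> (0 < t)%R ->
  measurable [set w | extremal_integral f (X w) <= t%:E].
Proof.
move=> Uf t0; rewrite (_ : [set w | _] =
    \bigcap_n [set w | max_scaled n (lev f) r w <= t%:E]).
  apply: bigcapT_measurable => n; apply: measurable_max_scaled (ltW t0) => i.
  exact: compact_level.
apply/seteqP; split => w /=; first by move=> /EI_max_scaled le n _; exact: le.
by move=> le; apply/EI_max_scaled => // n; exact: le.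
Qed.

(** The finite maxima over the levels [r 0, ..., r (n - 1)] have Fréchet scales by max-stability and
    increase to the extremal integral. *)
Lemma extremal_integral_scale f : USC f ->
  exists a, frechet_scale P (fun w => extremal_integral f (X w)) a.
Proof.
move=> Uf; have [f0 [M fM] _ cf] := Uf.
have cK i : compact (lev f i) by exact: compact_level.
have [a aP] : {a : nat -> R & forall n, frechet_scale P (max_scaled n (lev f) r) (a n)}.
  apply: (@choice _ _ (fun n a => frechet_scale P (max_scaled n (lev f) r) a)) => n.
  by case: msX => _ scale_max; exact: scale_max.
(* [N] bounds [f] and is a nonnegative weight, as [max_stable] demands. The scale [b] of [N] times
   [X] on the support dominates every [a n], since levels above [N] are empty. *)
pose N := Num.max 0%R M.
have N0 : (0 <= N)%R by rewrite le_max lexx.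
have [b bP] : exists b, frechet_scale P
    (max_scaled 1 (fun=> closure [set x | (0 < f x)%R]) (fun=> N)) b.
  by case: msX => _; apply.
apply: (@frechet_scale_sup _ _ _ _ _ (fun n => max_scaled n (lev f) r) a b).
- by move=> n t t0; apply: measurable_max_scaled => //; exact: ltW.
- move=> n w; rewrite /max_scaled.
  exact: (@le_bigmax_ord _ _ 0 _ _ xpredT
    (fun i => (r i)%:E * X w (lev f i)) (leqnSn n)).
- by [].
- move=> n; apply: frechet_scale_le (aP n) bP => [t t0|t t0|w].
  + by apply: measurable_max_scaled => //; exact: ltW.
  + by apply: measurable_max_scaled => //; exact: ltW.
  + have SMw := max_stable_SM w.
    have X0 := supmeasure_ge0 SMw.
    apply: bigmax_le => [|i _]; first exact: bigmax_ge_id.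
    apply: le_trans (le_bigmax _ _ ord0) => /=.
    have [rN|Nr] := leP (r i) N.
      apply: lee_pmul; rewrite ?lee_fin//; apply: supmeasure_le => // x [ri0 rif].
      by apply: subset_closure; exact: lt_le_trans rif.
    rewrite (_ : lev f i = set0).
      by case: SMw => _ -> _; rewrite mule0 mule_ge0// lee_fin.
    apply/seteqP; split => // x [_ /le_trans/(_ (fM x))].
    by apply/negP; rewrite -ltNge (le_lt_trans _ Nr)// le_max lexx orbT.
- by move=> w t t0; exact: EI_max_scaled.
Qed.

(** Since a scale exists, [xget] returns a genuine one and not its default 0. *)
Lemma tdf_scale f : USC f ->
  frechet_scale P (fun w => extremal_integral f (X w)) (tdf P X f).
Proof. by move=> /extremal_integral_scale[a aP]; apply: xgetI aP. Qed.

Lemma tdf_ge0 f : USC f -> (0 <= tdf P X f)%R.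
Proof. by move=> /tdf_scale[]. Qed.

Lemma tdf_eq f a : USC f ->
  frechet_scale P (fun w => extremal_integral f (X w)) a -> tdf P X f = a.
Proof. by move=> Uf; apply: frechet_scale_uniq; exact: tdf_scale. Qed.

Lemma tdf_le f g : USC f -> USC g -> (forall x, f x <= g x)%R ->
  (tdf P X f <= tdf P X g)%R.
Proof.
move=> Uf Ug fg; apply: frechet_scale_le (tdf_scale Uf) (tdf_scale Ug).
- by move=> t; exact: measurable_extremal_integral.
- by move=> t; exact: measurable_extremal_integral.
- by move=> w; apply: extremal_integral_mono fg _; [exact: max_stable_SM|case: Uf].
Qed.

(** The level set of [c * f] at [c * s] is that of [f] at [s], so the integral of [c * f] is at most
    [t] exactly when that of [f] is at most [t / c]. *)
Lemma tdfZ (c : R) f : (0 < c)%R -> USC f ->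
  tdf P X (fun x => c * f x)%R = (c * tdf P X f)%R.
Proof.
move=> c0 Uf; apply: tdf_eq; first exact: USCZ.
split; first by rewrite mulr_ge0 ?(ltW c0)// tdf_ge0.
move=> t t0; have tc0 : (0 < t / c)%R by rewrite divr_gt0.
rewrite (_ : [set w | _] = [set w | extremal_integral f (X w) <= (t / c)%:E]).
  case: (tdf_scale Uf) => _ ->//; congr (expR (- _))%:E.
  by rewrite invf_div mulrCA mulrA.
apply/seteqP; split => w /=; have SMw := max_stable_SM w.
  move=> /(extremal_integral_le SMw (USCZ c0 Uf) (ltW t0)) le.
  apply/(extremal_integral_le SMw Uf (ltW tc0)) => s.
  have := le (c * s)%R; rewrite (_ : level _ _ = level f s).
    have /fineK <- := supmeasure_fin_num SMw (@compact_level _ _ f s Uf).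
    by rewrite -!EFinM !lee_fin ler_pdivlMr// -mulrA mulrC.
  by apply/seteqP; split => x []; rewrite /level/= pmulr_rgt0// ler_pM2l.
move=> /(extremal_integral_le SMw Uf (ltW tc0)) le.
apply/(extremal_integral_le SMw (USCZ c0 Uf) (ltW t0)) => s.
have := le (c^-1 * s)%R; rewrite (_ : level _ (_ * _) = level (fun x => c * f x)%R s).
  have /fineK <- := supmeasure_fin_num SMw (compact_level (s := s) (USCZ c0 Uf)).
  have cs (p : R) : (c^-1 * s * p * c = s * p)%R.
    by rewrite mulrC !mulrA mulfV ?mul1r// gt_eqF.
  by rewrite -!EFinM !lee_fin ler_pdivlMr// cs.
by apply/seteqP; split => x []; rewrite /level/= pmulr_rgt0 ?invr_gt0// ler_pdivrMl.
Qed.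

Lemma USC_indicT (K : set E) : compact K -> USC (\1_K : E -> R).
Proof.
move=> /(@USC_indic R E 1 K E_T2 ler01); congr USC.
by apply/funext => x; rewrite mul1r.
Qed.

Lemma ecf0 : ecf P X set0 = 0%R.
Proof.
apply: tdf_eq; first by apply: USC_indicT; exact: compact0.
split => // t t0; rewrite mul0r oppr0 expR0 (_ : [set w | _] = setT).
  exact: probability_setT.
apply/seteqP; split => // w _ /=; have SMw := max_stable_SM w.
have U0 : USC (\1_(set0 : set E) : E -> R) by apply: USC_indicT; exact: compact0.
apply/(extremal_integral_le SMw U0 (ltW t0)) => s; rewrite (_ : level _ _ = set0).
  by case: SMw => _ -> _; rewrite mule0 lee_fin ltW.
apply/seteqP; split => // x []; rewrite /level/= indicE in_set0 => s0.
by rewrite leNgt s0.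
Qed.

Lemma ecf_le (K L : set E) : compact K -> compact L -> K `<=` L ->
  (ecf P X K <= ecf P X L)%R.
Proof.
move=> cK cL KL; apply: tdf_le; [exact: USC_indicT|exact: USC_indicT|move=> x].
rewrite !indicE ler_nat; case: (boolP (x \in K)) => //; rewrite inE => /KL Lx.
by rewrite mem_set.
Qed.

Lemma ecf_ge0 (K : set E) : compact K -> (0 <= ecf P X K)%R.
Proof. by move=> /USC_indicT/tdf_ge0. Qed.

End max_stable_theory.

(** * Riemann sums of a nonincreasing function on the half-line *)

Section riemann_sum.
Local Open Scope ereal_scope.
Context {R : realType}.
Variables (h : R -> R) (B : R).
Hypotheses (h_noninc : forall s t : R, (0 < s)%R -> (s <= t)%R -> (h t <= h s)%R).
Hypotheses (h_ge0 : forall t : R, (0 < t)%R -> (0 <= h t)%R).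
Hypotheses (h_leB : forall t : R, (0 < t)%R -> (h t <= B)%R).
Local Notation mu := (@lebesgue_measure R).

Lemma measurable_nonincreasing : measurable_fun (`]0%R, +oo[%classic : set R) (EFin \o h).
Proof.
apply/measurable_EFinP; apply: (measurability _ (RGenCInfty.measurableE R)).
move=> _ [_ [r ->] <-]; apply: is_interval_measurable.
move=> x y [] /=; rewrite !in_itv/= !andbT => x0 _ [_ ry] z /andP[xz zy].
have z0 : (0 < z)%R by exact: lt_le_trans xz.
rewrite in_itv/= andbT; split=> //=; rewrite in_itv/= andbT in ry *.
by apply: le_trans ry _; exact: h_noninc.
Qed.

Let mh (D : set R) : D `<=` `]0%R, +oo[%classic -> measurable_fun D (EFin \o h).
Proof. by move=> D0; apply: measurable_funS D0 measurable_nonincreasing. Qed.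

Let Ioc_sub (a b : R) : (0 <= a)%R -> `]a, b]%classic `<=` `]0%R, +oo[%classic.
Proof.
by move=> a0 x /=; rewrite !in_itv/= andbT => /andP[ax _]; exact: le_lt_trans ax.
Qed.

Lemma integral_Ioc_const (a b r : R) : (a <= b)%R ->
  \int[mu]_(x in `]a, b]) (cst r%:E x) = ((b - a) * r)%:E.
Proof.
move=> ab; rewrite integral_cst//= lebesgue_measure_itv/= lte_fin.
case: ltP => [_|ba]; first by rewrite -EFinB -EFinM mulrC.
by rewrite mule0 (_ : b - a = 0)%R ?mul0r//; apply/eqP; rewrite subr_eq0 eq_le ba.
Qed.

Lemma integral_nonincreasing_le (a b r : R) : (0 <= a <= b)%R ->
  (forall x, (a < x)%R -> (h x <= r)%R) ->
  \int[mu]_(x in `]a, b]) (h x)%:E <= ((b - a) * r)%:E.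
Proof.
move=> /andP[a0 ab] hr; rewrite -integral_Ioc_const//.
apply: ge0_le_integral => //.
- by move=> x /(Ioc_sub a0)/=; rewrite in_itv/= andbT lee_fin => /h_ge0.
- by apply: mh; exact: Ioc_sub.
- by move=> x; rewrite /= in_itv/= lee_fin => /andP[/hr].
Qed.

Lemma integral_nonincreasing_ge (a b : R) : (0 <= a <= b)%R ->
  ((b - a) * h b)%:E <= \int[mu]_(x in `]a, b]) (h x)%:E.
Proof.
move=> /andP[a0]; rewrite le_eqVlt => /orP[/eqP <-|ab].
  by rewrite subrr mul0r set_itv_ge ?bnd_simp ?ltxx// integral_set0.
have b0 := le_lt_trans a0 ab; rewrite -integral_Ioc_const ?(ltW ab)//.
apply: ge0_le_integral => //.
- by move=> x _; rewrite lee_fin h_ge0.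
- by apply: mh; exact: Ioc_sub.
- move=> x; rewrite /= in_itv/= lee_fin => /andP[ax xb]; apply: h_noninc => //.
  exact: le_lt_trans ax.
Qed.

Variables (c : R) (c_gt0 : (0 < c)%R).

Let integral_step (n : nat) :
  \int[mu]_(x in `]0%R, (c * n.+1%:R)%R]) (h x)%:E =
  \int[mu]_(x in `]0%R, (c * n%:R)%R]) (h x)%:E +
  \int[mu]_(x in `](c * n%:R)%R, (c * n.+1%:R)%R]) (h x)%:E.
Proof.
have cn0 : (0 <= c * n%:R)%R by rewrite mulr_ge0// ltW.
have cnS : (c * n%:R <= c * n.+1%:R)%R by rewrite ler_pM2l// ler_nat.
have E : `]0%R, (c * n.+1%:R)%R]%classic =
    `]0%R, (c * n%:R)%R] `|` `](c * n%:R)%R, (c * n.+1%:R)%R].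
  by rewrite -itv_bndbnd_setU// bnd_simp.
rewrite E ge0_integral_setU//.
- by rewrite -E; apply: mh; exact: Ioc_sub.
- by rewrite -E => x /(Ioc_sub (lexx _))/=; rewrite in_itv/= andbT lee_fin => /h_ge0.
- apply/disj_set2P/seteqP; split => // x [] /=; rewrite !in_itv/=.
  by move=> /andP[_ xc] /andP[]; rewrite ltNge xc.
Qed.

Lemma riemann_sum_le_integral (n : nat) :
  (c * \sum_(k < n) h (c * k.+1%:R))%:E <=
  \int[mu]_(x in `]0%R, (c * n%:R)%R]) (h x)%:E.
Proof.
elim: n => [|n IH].
  by rewrite big_ord0 !mulr0 set_itv_ge ?bnd_simp ?ltxx// integral_set0.
rewrite big_ord_recr/= mulrDr EFinD integral_step; apply: leeD => //.
apply: le_trans (integral_nonincreasing_ge _).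
  by rewrite -mulrBr -natrB// subSnn mulr1.
by rewrite mulr_ge0 ?(ltW c_gt0)//= ler_pM2l// ler_nat.
Qed.

(** On each cell [h] is at most its value at the left endpoint, which is the sample point of the
    preceding cell. The first cell has no predecessor and is bounded by [B]. *)
Lemma integral_le_riemann_sum (n : nat) :
  \int[mu]_(x in `]0%R, (c * n.+1%:R)%R]) (h x)%:E <=
  (c * \sum_(k < n) h (c * k.+1%:R) + c * B)%:E.
Proof.
elim: n => [|n IH].
  rewrite big_ord0 mulr0 add0r mulr1; have := @integral_nonincreasing_le 0 c B.
  by rewrite subr0; apply; rewrite ?lexx ?(ltW c_gt0).
rewrite [in leRHS]big_ord_recr [in leRHS]mulrDr addrAC EFinD integral_step.
apply: leeD => //.
apply: (le_trans (@integral_nonincreasing_le _ _ (h (c * n.+1%:R)) _ _)).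
- by rewrite mulr_ge0 ?(ltW c_gt0)//= ler_pM2l// ler_nat.
- by move=> x cx; apply: h_noninc; [rewrite mulr_gt0|exact: ltW].
- by rewrite -mulrBr -natrB// subSnn mulr1.
Qed.

Lemma riemann_sum_integral (n : nat) : (forall t, (c * n%:R < t)%R -> h t = 0%R) ->
  (c * \sum_(k < n) h (c * k.+1%:R))%:E <=
    \int[mu]_(t in `]0%R, +oo[) (h t)%:E <=
  (c * \sum_(k < n) h (c * k.+1%:R) + c * B)%:E.
Proof.
move=> h0; have c0 := ltW c_gt0.
(* The range is cut one cell beyond [c * n], because the upper bound covers one cell more than the
   sum has terms. *)
have -> : \int[mu]_(t in `]0%R, +oo[) (h t)%:E =
    \int[mu]_(x in `]0%R, (c * n.+1%:R)%R]) (h x)%:E.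
  have E : `]0%R, +oo[%classic =
      `]0%R, (c * n.+1%:R)%R] `|` `](c * n.+1%:R)%R, +oo[.
    by rewrite -itv_bndbnd_setU// bnd_simp// mulr_ge0.
  rewrite E ge0_integral_setU//.
  - rewrite [X in _ + X](_ : _ = 0) ?adde0//; apply: integral0_eq => x /=.
    rewrite in_itv/= andbT => cx; rewrite h0//; apply: le_lt_trans cx.
    by rewrite ler_pM2l// ler_nat.
  - by rewrite -E; exact: measurable_nonincreasing.
  - by rewrite -E => x /=; rewrite in_itv/= andbT lee_fin => /h_ge0.
  - apply/disj_set2P/seteqP; split => // x [] /=; rewrite !in_itv/= andbT.
    by move=> /andP[_ xc]; rewrite ltNge xc.
rewrite integral_le_riemann_sum andbT integral_step.
apply: le_trans (riemann_sum_le_integral n) _; rewrite leeDl// integral_ge0// => x.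
have cn0 : (0 <= c * n%:R)%R by rewrite mulr_ge0.
by move=> /(Ioc_sub cn0)/=; rewrite in_itv/= andbT lee_fin => /h_ge0.
Qed.

End riemann_sum.

(** * Real arithmetic for letting the mesh tend to 0 *)

Section sandwich.
Context {R : realFieldType}.
Implicit Types x y b : R.

Lemma eq_of_norm_le x y b : 0 <= b ->
  (forall c, 0 < c -> `|x - y| <= c * b) -> x = y.
Proof.
move=> b0 xy; apply/eqP; rewrite -subr_eq0 -normr_le0; apply/ler_addgt0Pr => e e0.
have b1 : 0 < b + 1 by rewrite ltr_wpDl.
rewrite add0r; apply: le_trans (xy _ (divr_gt0 e0 b1)) _.
by rewrite -mulrA ler_piMr ?(ltW e0)// mulrC ler_pdivrMr// mul1r lerDl.
Qed.

Lemma dist_le_of_sandwich x y s b :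
  s <= x <= s + b -> s <= y <= s + b -> `|x - y| <= b.
Proof.
by move=> /andP[? ?] /andP[? ?]; rewrite ler_norml; apply/andP; split; lra.
Qed.

(** To be read with [s1], [s2], [s] the Riemann sums of [f], [g], [f + g], with [x1], [x2], [x]
    their tail dependences and with [b1], [b2], [b] the extremal coefficients of the supports. *)
Lemma dist_le_of_sandwich2 c x1 x2 x s1 s2 s b1 b2 b :
  0 <= c * b1 -> 0 <= c * b2 -> 0 <= c * b -> s - c * b <= s1 + s2 <= s ->
  s1 <= x1 <= s1 + c * b1 -> s2 <= x2 <= s2 + c * b2 -> s <= x <= s + c * b ->
  `|x - (x1 + x2)| <= c * (b1 + b2 + (b + b)).
Proof.
rewrite !mulrDr => ? ? ? /andP[? ?] /andP[? ?] /andP[? ?] /andP[? ?].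
by rewrite ler_norml; apply/andP; split; lra.
Qed.

End sandwich.

(** * Level sets of a sum of two comonotone integer-valued functions *)

Section comonotone_levels.

(* At each step the smaller of the two nested top level sets {F > N1} and
   {G > N2} is split off as the top level set of the sum. *)
Lemma comonotone_level_sum (R : nmodType) (T : Type) (theta : set T -> R)
    (F G : T -> nat) (N1 N2 : nat) :
  (forall x y, (F x < F y)%N -> (G x <= G y)%N) ->
  \sum_(j < N1 + N2) theta [set x | (j < minn (F x) N1 + minn (G x) N2)%N] =
  \sum_(k < N1) theta [set x | (k < F x)%N] +
  \sum_(k < N2) theta [set x | (k < G x)%N].
Proof.
move=> FG; have [n] := ubnP (N1 + N2); elim: n N1 N2 => // n IH [|N1] [|N2] Nn.
- by rewrite !big_ord0 addr0.
- rewrite big_ord0 !add0r; apply: eq_bigr => -[j /= jN] _; congr theta.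
  by apply/seteqP; split => x /=; lia.
- rewrite [X in _ + X]big_ord0 addr0 addn0; apply: eq_bigr => -[j /= jN] _.
  by congr theta; apply/seteqP; split => x /=; lia.
have [FsubG|/existsNP[x /not_implyP[Fx /negP Gx]]] :=
    pselect (forall x, (N1 < F x)%N -> (N2 < G x)%N).
  (* The top level of the sum needs both caps attained, so it is the smaller set [{F > N1}].
     Lowering the cap of [F] by one leaves the other levels unchanged. *)
  rewrite [X in _ = X + _]big_ord_recr/= addSn big_ord_recr/=.
  rewrite addrAC -IH; last by move: Nn; rewrite addSn.
  congr (_ + theta _); last by apply/seteqP; split => x /=; have := FsubG x; lia.
  apply: eq_bigr => -[j /= jN] _; congr theta.
  by apply/seteqP; split => x /=; have := FsubG x; lia.
(* Otherwise [F y <= N1 < F x], and [FG] would give [G y <= G x <= N2]. *)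
have GsubF y : (N2 < G y)%N -> (N1 < F y)%N.
  by have := FG y x; lia.
rewrite [X in _ = _ + X]big_ord_recr/= addnS big_ord_recr/=.
rewrite addrA -IH; last by move: Nn; rewrite addnS.
congr (_ + theta _); last by apply/seteqP; split => y /=; have := GsubF y; lia.
apply: eq_bigr => -[j /= jN] _; congr theta.
by apply/seteqP; split => y /=; have := GsubF y; lia.
Qed.

End comonotone_levels.

(** * Staircase approximations from below *)

Section staircase.
Context {R : realType} {E : topologicalType}.
Hypothesis E_T2 : hausdorff_space E.
Implicit Types f g : E -> R.

Lemma comonotonic_of_total f g (v : E -> nat) :
  (forall x y, (v x <= v y)%N -> f x <= f y) ->
  (forall x y, (v x <= v y)%N -> g x <= g y) -> comonotonic f g.
Proof.
move=> fv gv x y; have [xy|/ltnW xy] := leqP (v x) (v y).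
  by rewrite mulr_le0// subr_le0; [exact: fv|exact: gv].
by rewrite mulr_ge0// subr_ge0; [exact: fv|exact: gv].
Qed.

(** This is [f] rounded down to a multiple of [c]; the cap [m] allows induction on the number of
    steps. *)
Definition stair f (c : R) (m : nat) (x : E) : R :=
  c * (minn (Num.truncn (f x / c)) m)%:R.

Variables (c : R) (c_gt0 : 0 < c).

Lemma levelE f (k : nat) :
  level f (c * k.+1%:R) = [set x | (k < Num.truncn (f x / c))%N].
Proof.
rewrite level_gt0 ?mulr_gt0//; apply/seteqP; split => x /=;
  by rewrite truncn_gt_nat ler_pdivlMr// mulrC.
Qed.

Lemma stairS f m :
  stair f c m.+1 = stair f c m \+ (fun x => c * \1_(level f (c * m.+1%:R)) x).
Proof.
apply/funext => x; rewrite /stair/= levelE indicE -mulrDr -natrD.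
congr (c * _%:R); have [mf|fm] := ltnP m (Num.truncn (f x / c)).
  by rewrite mem_set//; lia.
by rewrite memNset/= ?ltnNge ?fm//; lia.
Qed.

(** The zero function is written as a multiple of an indicator so that [USC_indic] and [tdfZ] apply
    to it. *)
Lemma stair0 f : stair f c 0 = fun x => c * \1_(set0 : set E) x.
Proof. by apply/funext => x; rewrite /stair minn0 indicE in_set0. Qed.

Lemma USC_stair f m : USC f -> USC (stair f c m).
Proof.
move=> Uf; elim: m => [|m IH].
  by rewrite stair0; apply: USC_indic (ltW c_gt0) _ => //; exact: compact0.
rewrite stairS; apply: USCD IH _.
by apply: USC_indic (ltW c_gt0) _ => //; exact: compact_level.
Qed.

Lemma stair_le f m x : 0 <= f x -> stair f c m x <= f x.
Proof.
move=> f0; have fc0 : 0 <= f x / c by rewrite divr_ge0 ?(ltW c_gt0).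
have /andP[+ _] := truncn_itv fc0; rewrite ler_pdivlMr// mulrC; apply: le_trans.
by rewrite ler_pM2l// ler_nat geq_minl.
Qed.

Lemma stair_ge f m x : 0 <= f x -> f x < c * m.+1%:R -> f x < stair f c m x + c.
Proof.
move=> f0 fm; have fc0 : 0 <= f x / c by rewrite divr_ge0 ?(ltW c_gt0).
rewrite /stair (minn_idPl _); last first.
  by rewrite truncn_le_nat ltr_pdivrMr// mulrC.
have /andP[_] := truncn_itv fc0.
by rewrite ltr_pdivrMr// -natr1 mulrDl mul1r mulrC.
Qed.

Lemma exists_mesh_bound f : USC f -> exists N : nat, forall x, f x < c * N%:R.
Proof.
move=> [_ [M fM] _ _]; exists (Num.truncn (M / c)).+1 => x.
apply: le_lt_trans (fM x) _; rewrite mulrC -ltr_pdivrMr//.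
exact: truncnS_gt.
Qed.

End staircase.

(** * Comonotonic additivity and the Choquet integral *)

Section choquet.
Context {R : realType} {E : topologicalType}.
Context {d : measure_display} {Omega : measurableType d}.
Variables (P : probability Omega R) (X : Omega -> set E -> \bar R).
Hypotheses (E_T2 : hausdorff_space E) (msX : max_stable P X).
Implicit Types f g : E -> R.
Local Notation theta := (ecf P X).

(** The Riemann sum of the Choquet integral of [f], with mesh [c] and right endpoints. *)
Definition choquet_sum f (c : R) (N : nat) : R :=
  c * \sum_(k < N) theta (level f (c * k.+1%:R)).

Let supp f := closure [set x | 0 < f x].

Let level_supp f t : level f t `<=` supp f.
Proof. by move=> x [t0 tf]; apply: subset_closure; exact: lt_le_trans tf. Qed.

Lemma ecf_level_le f s t : USC f -> 0 < s -> s <= t ->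
  theta (level f t) <= theta (level f s).
Proof.
move=> Uf s0 st; apply: ecf_le => //; try exact: compact_level.
by move=> x [_ tf]; split => //; exact: le_trans tf.
Qed.

Lemma choquet_sum_integral f (c : R) (N : nat) : USC f -> 0 < c ->
  (forall x, f x < c * N%:R) ->
  ((choquet_sum f c N)%:E <= choquet_integral theta f <=
    (choquet_sum f c N + c * theta (supp f))%:E)%E.
Proof.
move=> Uf c0 fN; have csupp : compact (supp f) by case: Uf.
rewrite /choquet_sum (_ : choquet_integral _ _ =
   (\int[@lebesgue_measure R]_(t in `]0%R, +oo[) (theta (level f t))%:E)%E).
  apply: (@riemann_sum_integral R (fun t => theta (level f t)) (theta (supp f))
    _ _ _ c c0 N).
  - by move=> s t; exact: ecf_level_le.
  - by move=> t _; apply: ecf_ge0 => //; exact: compact_level.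
  - by move=> t _; apply: ecf_le => //; exact: compact_level.
  - move=> t Nt; rewrite (_ : level f t = set0); first exact: ecf0.
    apply/seteqP; split => // x [_ tf].
    by have := lt_trans (fN x) Nt; rewrite ltNge tf.
apply: eq_integral => t; rewrite inE/= in_itv/= andbT => t0.
by rewrite level_gt0.
Qed.

Section additive.
Hypothesis tdfD : forall f g, USC f -> USC g -> comonotonic f g ->
  tdf P X (f \+ g) = tdf P X f + tdf P X g.

(** Each new step [c * \1_(level f (c * m.+1))] is comonotone with the staircase below it: both are
    nondecreasing in the integer part of [f / c]. *)
Lemma tdf_stair f c m : 0 < c -> USC f ->
  tdf P X (stair f c m) = choquet_sum f c m.
Proof.
move=> c0 Uf; have UI (A : set E) : compact A -> USC (\1_A : E -> R).
  exact: USC_indicT.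
rewrite /choquet_sum; elim: m => [|m IH].
  rewrite stair0 tdfZ//; last by apply: UI; exact: compact0.
  by rewrite -/(ecf P X set0) ecf0// big_ord0.
have cl := compact_level (s := c * m.+1%:R) Uf.
rewrite stairS// tdfD.
- by rewrite IH tdfZ//; [rewrite big_ord_recr/= mulrDr|exact: UI].
- exact: USC_stair.
- exact: USC_indic (ltW c0) cl.
apply: (@comonotonic_of_total _ _ _ _ (fun x => Num.truncn (f x / c))) => x y /= xy.
  by rewrite /stair ler_pM2l// ler_nat leq_min !geq_min xy leqnn orbT.
rewrite levelE// !indicE ler_pM2l// ler_nat.
have [mx|mx] := ltnP m (Num.truncn (f x / c)); last by rewrite memNset//= ltnNge mx.
by rewrite !mem_set//=; exact: leq_trans xy.
Qed.

(** The function lies between its staircase and the staircase plus [c] times the indicator of the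
    support, and additivity evaluates the latter too. *)
Lemma tdf_choquet_sum f c N : 0 < c -> USC f -> (forall x, f x < c * N%:R) ->
  choquet_sum f c N <= tdf P X f <= choquet_sum f c N + c * theta (supp f).
Proof.
move=> c0 Uf fN; have [f0 _ _ csupp] := Uf.
have Us := USC_stair E_T2 c0 N Uf.
have UI := USC_indic E_T2 (ltW c0) csupp.
have USI := USC_indicT E_T2 csupp.
rewrite -tdf_stair//; apply/andP; split.
  by apply: tdf_le => // x; exact: stair_le.
rewrite -tdfZ// -tdfD//; last first.
  (* The extra 1 on the support ranks its points strictly above the outside, where [f] vanishes; the
     integer part alone could not tell them apart. *)
  apply: (@comonotonic_of_total _ _ _ _
      (fun x => (x \in supp f) + Num.truncn (f x / c))%N) => x y.
    move=> xy; rewrite /stair ler_pM2l// ler_nat; move: xy.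
    have [xs|xs] := boolP (x \in supp f).
      move: (Num.truncn (f x / c)) (Num.truncn (f y / c)) => u v.
      by case: (y \in supp f) => /=; lia.
    suff -> : Num.truncn (f x / c) = 0%N by rewrite min0n.
    have -> : f x = 0; last by rewrite mul0r truncn0.
    apply/eqP; rewrite eq_le f0 andbT leNgt; apply: contra xs => fx.
    by rewrite inE; exact: subset_closure.
  rewrite !indicE ler_pM2l// ler_nat; have [ys|ys] := boolP (y \in supp f).
    by case: (x \in supp f).
  suff -> : Num.truncn (f y / c) = 0%N by lia.
  have -> : f y = 0; last by rewrite mul0r truncn0.
  apply/eqP; rewrite eq_le f0 andbT leNgt; apply: contra ys => fx.
  by rewrite inE; exact: subset_closure.
apply: tdf_le => //; first exact: USCD.
move=> x /=; rewrite indicE; have [fx|fx] := ltP 0 (f x).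
  rewrite mem_set; last exact: subset_closure.
  rewrite mulr1 ltW// stair_ge//; apply: lt_le_trans (fN x) _.
  by rewrite ler_pM2l// ler_nat.
have -> : f x = 0 by apply/eqP; rewrite eq_le f0 fx.
by rewrite addr_ge0 ?mulr_ge0 ?(ltW c0)// /stair.
Qed.

Lemma tdf_choquet f : USC f -> (tdf P X f)%:E = choquet_integral theta f.
Proof.
move=> Uf; have csupp : compact (supp f) by case: Uf.
have B0 : 0 <= theta (supp f) by exact: ecf_ge0.
(* Mesh 1 serves only to show that the Choquet integral is finite. *)
have [N1 fN1] := exists_mesh_bound (@ltr01 R) Uf.
have /andP[I0 I1] := choquet_sum_integral Uf ltr01 fN1.
have : choquet_integral theta f \is a fin_num.
  by rewrite fin_numE -ltNye -ltey (lt_le_trans _ I0) ?ltNyr// (le_lt_trans I1)// ltry.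
move=> /fineK IE; rewrite -IE; congr EFin; apply: (eq_of_norm_le B0) => c c0.
have [N fN] := exists_mesh_bound c0 Uf.
have := choquet_sum_integral Uf c0 fN; rewrite -IE !lee_fin.
exact: dist_le_of_sandwich (tdf_choquet_sum c0 Uf fN).
Qed.

End additive.

(* The level sets of the sum of the two staircases interlace with those of
   f + g, and comonotone_level_sum evaluates theta on the former. *)
Lemma choquet_sumD f g c N : 0 < c -> USC f -> USC g -> comonotonic f g ->
  (forall x, f x < c * N%:R) -> (forall x, g x < c * N%:R) ->
  choquet_sum (f \+ g) c (N + N) - c * theta (supp (f \+ g)) <=
    choquet_sum f c N + choquet_sum g c N <= choquet_sum (f \+ g) c (N + N).
Proof.
move=> c0 Uf Ug fg fN gN; have Ufg := USCD Uf Ug.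
have [f0 _ _ _] := Uf; have [g0 _ _ _] := Ug.
pose F x := Num.truncn (f x / c); pose G x := Num.truncn (g x / c).
(* Comonotonicity survives rounding: [F x < F y] forces [f x < f y], which excludes [g y < g x]. *)
have FG x y : (F x < F y)%N -> (G x <= G y)%N.
  move=> Fxy; apply: le_truncn; rewrite ler_pM2r ?invr_gt0// leNgt; apply/negP => gyx.
  have fxy : f x < f y.
    rewrite ltNge; apply: contraTN Fxy; rewrite -leqNgt => fyx.
    by apply: le_truncn; rewrite ler_pM2r ?invr_gt0.
  have := fg x y; rewrite leNgt => /negP; apply.
  by rewrite nmulr_rlt0 ?subr_gt0// subr_lt0.
pose q := stair f c N \+ stair g c N.
have Uq : USC q by apply: USCD; exact: USC_stair.
have qE x : q x = c * (minn (F x) N + minn (G x) N)%:R.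
  by rewrite /q/= /stair -mulrDr -natrD.
have lq (j : nat) : level q (c * j.+1%:R) = [set x | (j < minn (F x) N + minn (G x) N)%N].
  rewrite level_gt0 ?mulr_gt0//; apply/seteqP; split => x /=;
    by rewrite qE ler_pM2l// ler_nat.
have qle x : q x <= (f \+ g) x by apply: lerD; exact: stair_le.
have cN x h : h x < c * N%:R -> h x < c * N.+1%:R.
  by move=> /lt_le_trans; apply; rewrite ler_pM2l// ler_nat.
have qgt x : (f \+ g) x < q x + c * 2%:R.
  rewrite mulr_natr mulr2n addrACA; apply: ltrD; apply: stair_ge => //; exact: cN.
pose Q (j : nat) := theta (level q (c * j.+1%:R)).
have -> : choquet_sum f c N + choquet_sum g c N =
    c * \sum_(j < N + N) Q j.
  rewrite /choquet_sum -mulrDr; congr (c * _).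
  have levels h : \sum_(k < N) theta (level h (c * k.+1%:R)) =
      \sum_(k < N) theta [set x | (k < Num.truncn (h x / c))%N].
    by apply: eq_bigr => k _; rewrite (levelE c0).
  apply: etrans (congr2 +%R (levels f) (levels g)) _.
  apply: etrans (esym (comonotone_level_sum theta N N FG)) _.
  by apply: eq_bigr => j _; rewrite /Q lq.
have csupp : compact (supp (f \+ g)) by case: Ufg.
pose H (j : nat) := theta (level (f \+ g) (c * j.+1%:R)).
have QH j : Q j <= H j.
  apply: (ecf_le E_T2 msX (compact_level Uq) (compact_level Ufg)) => x [cj jq].
  by split; [|exact: le_trans (qle x)].
(* Where [f + g >= c * (j + 2)], [qgt] gives [q > c * j], hence [q >= c * (j + 1)] since [q] takes
   multiples of [c] as values. *)
have HQ j : H j.+1 <= Q j.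
  apply: (ecf_le E_T2 msX (compact_level Ufg) (compact_level Uq)).
  rewrite lq => x [_ jfg] /=; have := le_lt_trans jfg (qgt x).
  by rewrite qE -mulrDr ltr_pM2l// -natrD ltr_nat; lia.
have H0 : H 0%N <= theta (supp (f \+ g)).
  exact: (ecf_le E_T2 msX (compact_level Ufg) csupp (@level_supp _ _)).
have Q_ge0 j : 0 <= Q j by exact: (ecf_ge0 E_T2 msX (compact_level Uq)).
have -> : choquet_sum (f \+ g) c (N + N) = c * \sum_(j < N + N) H j by [].
clearbody H Q; apply/andP; split; last first.
  by rewrite (ler_pM2l c0); apply: ler_sum => j _; exact: QH.
rewrite -mulrBr (ler_pM2l c0) lerBlDr; case: (N + N)%N => [|n].
  by rewrite !big_ord0 add0r; exact: le_trans (Q_ge0 0%N) (le_trans (QH 0%N) H0).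
(* The first [H] is absorbed by the support term, the others are matched by [HQ], and the last [Q],
   being nonnegative, is dropped. *)
rewrite big_ord_recl [X in _ <= X + _]big_ord_recr/= [leLHS]addrC.
apply: lerD H0; apply: ler_wpDr => //.
by apply: ler_sum => j _; exact: HQ.
Qed.

(** The Choquet formula puts all three tail dependences near their Riemann sums; [choquet_sumD]
    compares these sums up to an error proportional to [c]. *)
Lemma choquet_tdfD f g :
  (forall f, USC f -> (tdf P X f)%:E = choquet_integral theta f) ->
  USC f -> USC g -> comonotonic f g ->
  tdf P X (f \+ g) = tdf P X f + tdf P X g.
Proof.
move=> tdfE Uf Ug fg; have Ufg := USCD Uf Ug.
have bound h c N : USC h -> 0 < c -> (forall x, h x < c * N%:R) ->
    choquet_sum h c N <= tdf P X h <= choquet_sum h c N + c * theta (supp h).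
  by move=> Uh c0 hN; have := choquet_sum_integral Uh c0 hN; rewrite -tdfE// !lee_fin.
have B0 h : USC h -> 0 <= theta (supp h) by case=> _ _ _ ch; exact: ecf_ge0.
have [[Bf Bg] Bfg] := (B0 _ Uf, B0 _ Ug, B0 _ Ufg).
have B_ge0 := addr_ge0 (addr_ge0 Bf Bg) (addr_ge0 Bfg Bfg).
apply: (eq_of_norm_le B_ge0) => c c0.
have [N1 fN1] := exists_mesh_bound c0 Uf; have [N2 gN2] := exists_mesh_bound c0 Ug.
pose N := maxn N1 N2.
have fN x : f x < c * N%:R.
  by apply: lt_le_trans (fN1 x) _; rewrite ler_pM2l// ler_nat leq_maxl.
have gN x : g x < c * N%:R.
  by apply: lt_le_trans (gN2 x) _; rewrite ler_pM2l// ler_nat leq_maxr.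
have fgN x : (f \+ g) x < c * (N + N)%:R by rewrite natrD mulrDr ltrD.
exact: (dist_le_of_sandwich2 (mulr_ge0 (ltW c0) Bf) (mulr_ge0 (ltW c0) Bg)
  (mulr_ge0 (ltW c0) Bfg) (choquet_sumD c0 Uf Ug fg fN gN)
  (bound _ _ _ Uf c0 fN) (bound _ _ _ Ug c0 gN) (bound _ _ _ Ufg c0 fgN)).
Qed.

End choquet.

(** * Extremal integrals of maxima of scaled indicators *)

Section maxima_of_indicators.
Context {R : realType} {E : topologicalType}.
Hypothesis E_T2 : hausdorff_space E.
Implicit Types f g : E -> R.

Lemma USC_max f g : USC f -> USC g -> USC (fun x => Num.max (f x) (g x)).
Proof.
move=> [f0 [M fM] fc cf] [g0 [N gN] gc cg]; split.
- by move=> x; rewrite le_max f0.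
- exists (Num.max M N) => x.
  by rewrite ge_max !le_max fM gN orbT.
- move=> t; rewrite (_ : [set x | _] = [set x | t <= f x] `|` [set x | t <= g x]).
    exact: closedU.
  by apply/seteqP; split => x /=; rewrite le_max => /orP.
- apply: (subclosed_compact _ (compactU cf cg)); first exact: closed_closure.
  by rewrite -closureU; apply: closureS => x /=; rewrite lt_max => /orP.
Qed.

Lemma USC_bigmax (I : Type) (s : seq I) (F : I -> E -> R) :
  (forall i, USC (F i)) -> USC (fun x => \big[Num.max/0]_(i <- s) F i x).
Proof.
move=> UF; elim: s => [|i s IH].
  rewrite (_ : (fun x => _) = fun x => 0 * \1_(set0 : set E) x).
    exact: USC_indic E_T2 (lexx 0) (@compact0 E).
  by apply/funext => x; rewrite big_nil mul0r.
rewrite (_ : (fun x => _) =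
    fun x => Num.max (F i x) (\big[Num.max/0]_(j <- s) F j x)).
  exact: USC_max.
by apply/funext => x; rewrite big_cons.
Qed.

Definition max_indic (n : nat) (K : nat -> set E) (u : nat -> R) : E -> R :=
  fun x => \big[Num.max/0]_(i < n) (u i * \1_(K i) x).

Lemma USC_max_indic n K u : (forall i, compact (K i)) -> (forall i, 0 <= u i) ->
  USC (max_indic n K u).
Proof.
by move=> cK u0; apply: (@USC_bigmax _ _ (fun (i : 'I_n) x => u i * \1_(K i) x)) => i;
  exact: USC_indic.
Qed.

(** The level set at [u i] contains [K i]. Conversely, the level set at [s > 0] is covered by the
    [K i] with [u i >= s], on each of which [phi] is at most [t / s]; finite maxitivity
    concludes. *)
Lemma extremal_integral_max_indic (U : nat -> set E) (phi : set E -> \bar R)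
    (n : nat) (K : nat -> set E) (u : nat -> R) (t : R) :
  compact_neighbourhoods U -> SM phi ->
  (forall i, compact (K i)) -> (forall i, 0 <= u i) -> 0 <= t ->
  (extremal_integral (max_indic n K u) phi <= t%:E)%E <->
  forall i, (i < n)%N -> ((u i)%:E * phi (K i) <= t%:E)%E.
Proof.
move=> UP SMphi cK u0 t0; have Um := USC_max_indic n cK u0.
have phi0 : phi set0 = 0%E by case: SMphi.
rewrite (extremal_integral_le SMphi Um t0); split => [le i ni|le s].
  apply: le_trans (le (u i)); have := u0 i; rewrite le_eqVlt => /orP[/eqP <-|ui0].
    by rewrite !mul0e.
  rewrite lee_wpmul2l ?lee_fin//; apply: supmeasure_le => // x Kx; split => //.
  apply: le_trans (le_bigmax _ _ (Ordinal ni)) => /=.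
  by rewrite indicE mem_set// mulr1.
have [s0|s0] := leP s 0.
  rewrite (_ : level _ _ = set0) ?phi0 ?mule0 ?lee_fin//.
  by apply/seteqP; split => // x [/lt_le_trans/(_ s0)]; rewrite ltxx.
have sub : level (max_indic n K u) s `<=`
    \big[setU/set0]_(i in [pred i : 'I_n | s <= u i]) K i.
  move=> x [_ sx]; rewrite -bigcup_pred; apply: contrapT => nK.
  move: sx; apply/negP; rewrite -ltNge; apply: bigmax_lt => // i _.
  rewrite ltNge; apply/negP => sui; apply: nK; exists i => /=.
    rewrite inE; apply: le_trans sui _.
    by rewrite ler_piMr// indicE; case: (_ \in _).
  apply: contrapT => nKx; move: sui.
  by rewrite indicE memNset// mulr0 leNgt s0.
have /fineK lE := supmeasure_fin_num SMphi (compact_level (s := s) Um).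
have : (phi (level (max_indic n K u) s) <= (t / s)%:E)%E.
  apply: le_trans (supmeasure_le SMphi sub) _.
  apply: (supmeasure_bigcup_compact E_T2 UP SMphi) => //.
    by rewrite divr_ge0// ltW.
  move=> i; rewrite inE => sui; have := le i (ltn_ord i).
  have /fineK <- := supmeasure_fin_num SMphi (cK i).
  rewrite -EFinM !lee_fin ler_pdivlMr// mulrC; apply: le_trans.
  by rewrite ler_wpM2l// fine_ge0//; exact: supmeasure_ge0.
by rewrite -lE -EFinM !lee_fin ler_pdivlMr// mulrC.
Qed.

End maxima_of_indicators.

(** * Cylinders generate the sup-vague Borel sets *)

Section uniqueness.
Context {R : realType} {E : topologicalType}.
Hypothesis E_T2 : hausdorff_space E.
Variable U : nat -> set E.
Hypothesis UP : compact_neighbourhoods U.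

Definition cylinder (n : nat) (K : nat -> set E) (x : nat -> R) :
    set (set E -> \bar R) :=
  [set phi | SM phi /\ forall i, (i < n)%N -> (phi (K i) <= (x i)%:E)%E].

(** The bounds are strictly positive so that their inverses can serve as weights in [max_indic]. *)
Definition cylinders : set (set (set E -> \bar R)) :=
  [set A | exists n K x, [/\ forall i, compact (K i), forall i, 0 < x i &
    A = cylinder n K x]].

Lemma cylinders_setI : setI_closed cylinders.
Proof.
move=> _ _ [n [K [x [cK x0 ->]]]] [m [L [y [cL y0 ->]]]].
exists (n + m)%N, (fun i => if (i < n)%N then K i else L (i - n)%N),
  (fun i => if (i < n)%N then x i else y (i - n)%N); split.
- by move=> i; case: ifP.
- by move=> i; case: ifP.
apply/seteqP; split => [phi [[SMphi Kx] [_ Ly]]|phi [SMphi KL]].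
  split => // i inm; case: ifPn => [/Kx //|]; rewrite -leqNgt => ni.
  by apply: Ly; rewrite ltn_subLR.
split; split => // i ni.
  by have := KL i; rewrite ni; apply; exact: ltn_addr.
have := KL (n + i)%N; rewrite ltn_add2l addKn (_ : (n + i < n)%N = false); last lia.
exact.
Qed.

Local Notation sigma := <<s SM, cylinders >>.

Let sigma0 : sigma set0. Proof. by case: (@smallest_sigma_algebra _ SM cylinders). Qed.
Let sigmaD A : sigma A -> sigma (SM `\` A).
Proof. by case: (@smallest_sigma_algebra _ SM cylinders) => _ + _; apply. Qed.
Let sigmaU (A : nat -> set (set E -> \bar R)) :
  (forall n, sigma (A n)) -> sigma (\bigcup_n A n).
Proof. by case: (@smallest_sigma_algebra _ SM cylinders) => _ _; apply. Qed.

Let sigma_SM : sigma SM.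
Proof. by have := sigmaD sigma0; rewrite setD0. Qed.

Let sigma_le K (x : R) : compact K -> 0 < x ->
  sigma [set phi | SM phi /\ (phi K <= x%:E)%E].
Proof.
move=> cK x0; apply: sub_sigma_algebra; exists 1%N, (fun=> K), (fun=> x); split => //.
by apply/seteqP; split => phi [SMphi Kx]; split => //; exact: (Kx 0%N).
Qed.

Let sigma_lt K (x : R) : compact K -> sigma [set phi | SM phi /\ (phi K < x%:E)%E].
Proof.
move=> cK; have [x0|x0] := leP x 0.
  rewrite (_ : [set phi | _] = set0)//; apply/seteqP; split => // phi [SMphi].
  by rewrite ltNge (le_trans _ (supmeasure_ge0 SMphi _))// lee_fin.
(* These bounds approach [x] from below; the maximum with [x / 2] keeps them positive, as cylinders
   require. *)
pose y m : R := Num.max (x - m.+1%:R^-1) (x / 2).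
rewrite (_ : [set phi | _] = \bigcup_m [set phi | SM phi /\ (phi K <= (y m)%:E)%E]).
  by apply: sigmaU => m; apply: sigma_le => //; rewrite lt_max divr_gt0// orbT.
apply/seteqP; split => phi; last first.
  move=> [m _ [SMphi Ky]]; split => //; apply: le_lt_trans Ky _.
  by rewrite lte_fin gt_max ltrBlDr ltrDl invr_gt0 ltr0n/=; lra.
move=> [SMphi]; have /fineK <- := supmeasure_fin_num SMphi cK.
rewrite lte_fin -subr_gt0 => Kx; exists (Num.truncn (x - fine (phi K))^-1) => //.
split => //; have /fineK <- := supmeasure_fin_num SMphi cK.
rewrite lee_fin le_max lerBrDl -lerBrDr; apply/orP; left.
rewrite invf_ple ?posrE// ltW//; exact: truncnS_gt.
Qed.

Let sigma_gt K (x : R) : compact K -> sigma [set phi | SM phi /\ (x%:E < phi K)%E].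
Proof.
move=> cK; have [x0|x0] := ltP x 0.
  rewrite (_ : [set phi | _] = SM); first exact: sigma_SM.
  apply/seteqP; split => [phi []//|phi SMphi].
  by split => //; rewrite (lt_le_trans _ (supmeasure_ge0 SMphi _))// lte_fin.
(* The bounds [x + 1 / (m + 1)] are positive even when [x = 0]. *)
rewrite (_ : [set phi | _] = \bigcup_m (SM `\`
    [set phi | SM phi /\ (phi K <= (x + m.+1%:R^-1)%:E)%E])).
  apply: sigmaU => m; apply: sigmaD; apply: sigma_le => //.
  by apply: ltr_wpDl; rewrite ?invr_gt0.
apply/seteqP; split => phi; last first.
  move=> [m _ [SMphi /not_andP[//|/negP]]]; rewrite -ltNge => xK; split => //.
  by apply: lt_trans xK; rewrite lte_fin ltrDl invr_gt0.
move=> [SMphi]; have /fineK fE := supmeasure_fin_num SMphi cK.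
rewrite -fE lte_fin -subr_gt0 => Kx.
exists (Num.truncn (fine (phi K) - x)^-1) => //; split => // -[_].
rewrite -fE lee_fin -lerBlDl; apply/negP; rewrite -ltNge.
by rewrite invf_plt ?posrE//; exact: truncnS_gt.
Qed.

Let sigma_gt_open G (x : R) : open G -> sigma [set phi | SM phi /\ (x%:E < phi G)%E].
Proof.
move=> oG; have [_ cU _] := UP.
rewrite (_ : [set phi | _] = \bigcup_m (if `[< closure (U m) `<=` G >]
    then [set phi | SM phi /\ (x%:E < phi (closure (U m)))%E] else set0)).
  by apply: sigmaU => m; case: ifP => // _; exact: sigma_gt.
apply/seteqP; split => phi.
  move=> [SMphi /(supmeasure_inner UP SMphi oG)[m mG xm]]; exists m => //.
  rewrite asboolT//; split => //; apply: lt_le_trans xm _.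
  by apply: supmeasure_le => //; exact: subset_closure.
move=> [m _]; case: asboolP => // mG [SMphi xm]; split => //.
by apply: lt_le_trans xm _; exact: supmeasure_le.
Qed.

(* A countable subbase of the sup-vague topology. *)
Let subbase (c : bool * nat * rat) : set (set E -> \bar R) :=
  let: (b, n, q) := c in
  if b then [set phi | SM phi /\ (phi (closure (U n)) < (ratr q)%:E)%E]
  else [set phi | SM phi /\ ((ratr q)%:E < phi (U n))%E].

Let sigma_subbase c : sigma (subbase c).
Proof.
have [oU cU _] := UP; case: c => -[[] n] q; first exact: sigma_lt.
exact: sigma_gt_open.
Qed.

Let basic (l : seq (bool * nat * rat)) : set (set E -> \bar R) :=
  [set phi | SM phi /\ forall c, c \in l -> subbase c phi].

Let sigma_basic l : sigma (basic l).
Proof.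
pose F k := if (k < size l)%N then SM `\` subbase (nth (true, 0%N, 0) l k) else set0.
rewrite (_ : basic l = SM `\` \bigcup_k F k).
  apply: sigmaD; apply: sigmaU => k; rewrite /F; case: ifP => // _.
  by apply: sigmaD; exact: sigma_subbase.
apply/seteqP; split => phi [SMphi lphi]; split => //.
  move=> [k _]; rewrite /F; case: ifP => // kl [_]; apply; apply: lphi.
  exact: mem_nth.
move=> c cl; apply: contrapT => cphi; apply: lphi; exists (index c l) => //.
by rewrite /F index_mem cl nth_index.
Qed.

(** Outer or inner approximation replaces the compact or open set by some [U n], and a rational fits
    into the strict inequality that remains. *)
Let subbase_refine B phi : supvague_subbase B -> B phi ->
  exists c, subbase c phi /\ subbase c `<=` B.
Proof.
have [_ cU _] := UP.
move=> [[K [x [cK ->]]]|[G [x [oG ->]]]] [SMphi].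
  move=> /(supmeasure_outer E_T2 UP SMphi cK)[n Kn].
  have /fineK fE := supmeasure_fin_num SMphi (cU n).
  rewrite -fE lte_fin => /rat_in_itvoo[q]; rewrite in_itv/= => /andP[nq qx].
  exists (true, n, q); split; first by split => //; rewrite -fE lte_fin.
  move=> psi [SMpsi psiq]; split => //; apply: le_lt_trans (supmeasure_le SMpsi Kn) _.
  apply: le_lt_trans (lt_trans psiq _); last by rewrite lte_fin; exact: qx.
  by apply: supmeasure_le => //; exact: subset_closure.
move=> /(supmeasure_inner UP SMphi oG)[n nG].
have Ufin : phi (U n) \is a fin_num.
  rewrite ge0_fin_numE; last exact: supmeasure_ge0.
  apply: (@le_lt_trans _ _ (phi (closure (U n)))).
    by apply: supmeasure_le => //; exact: subset_closure.
  by have := supmeasure_fin_num SMphi (cU n); rewrite ge0_fin_numE//;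
    exact: supmeasure_ge0.
move: (Ufin) => /fineK fE.
rewrite -fE lte_fin => /rat_in_itvoo[q]; rewrite in_itv/= => /andP[xq qn].
exists (false, n, q); split; first by split => //; rewrite -fE lte_fin.
move=> psi [SMpsi psiq]; split => //; apply: lt_trans (lt_le_trans psiq _).
  by rewrite lte_fin.
by apply: supmeasure_le => //; apply: subset_trans nG; exact: subset_closure.
Qed.

Lemma sigma_sub_SM A : sigma A -> A `<=` SM.
Proof.
suff : sigma `<=` [set A | A `<=` SM] by apply.
apply: smallest_sub => [|_ [n [K [x [_ _ ->]]]] phi []//].
split=> [//|B _|F FS]; first exact: subDsetl.
by apply: bigcup_sub => i _; exact: FS.
Qed.

(** An open set is the union of the sets [basic l] that it contains, and there are only countably
    many lists [l]. *)
Lemma supvague_open_sigma : supvague_open `<=` sigma.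
Proof.
move=> V [VSM Vnbhs].
pose F k := if unpickle k is Some l then
  if `[< basic l `<=` V >] then basic l else set0 else set0.
rewrite (_ : V = \bigcup_k F k).
  apply: (@sigmaU F) => k; rewrite /F; case: unpickle => [l|]; last exact: sigma0.
  by case: ifP => _; [exact: (sigma_basic l)|exact: sigma0].
apply/seteqP; split => phi; last first.
  by move=> [k _]; rewrite /F; case: unpickle => // l; case: asboolP => // + ?; apply.
move=> /Vnbhs[n [B [sB [+ BV]]]]; rewrite inE => -[SMphi Bphi].
have /choice[c cP] : forall i, exists c, (i < n)%N ->
    subbase c phi /\ subbase c `<=` B i.
  move=> i; have [ni|] := boolP (i < n)%N; last by exists (true, 0%N, 0).
  by have [c cP] := subbase_refine (sB i ni) (Bphi i ni); exists c.
pose l := [seq c i | i <- iota 0 n].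
have lV : basic l `<=` V.
  move=> psi [SMpsi lpsi]; apply: BV; split => // i ni.
  by apply: (cP i ni).2; apply: lpsi; apply: map_f; rewrite mem_iota.
exists (pickle l) => //; rewrite /F pickleK asboolT//; split => // _ /mapP[i + ->].
by rewrite mem_iota => /cP[].
Qed.

(** * Equality of laws from equality of tail dependence functionals *)

Section law.
Context {d1 d2 : measure_display}.
Context {Omega1 : measurableType d1} {Omega2 : measurableType d2}.
Variables (P1 : probability Omega1 R) (P2 : probability Omega2 R).
Variables (X1 : Omega1 -> set E -> \bar R) (X2 : Omega2 -> set E -> \bar R).
Hypotheses (ms1 : max_stable P1 X1) (ms2 : max_stable P2 X2).

Lemma preimage_cylinder (T : Type) (X : T -> set E -> \bar R) n K (x : nat -> R) :
  (forall w, SM (X w)) -> (forall i, compact (K i)) -> (forall i, 0 < x i) ->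
  X @^-1` cylinder n K x = [set w |
    (extremal_integral (max_indic n K (fun i => (x i)^-1)%R) (X w) <= 1%:E)%E].
Proof.
move=> SMX cK x0; apply/seteqP; split => w /=; have xV0 i : 0 <= (x i)^-1.
- by rewrite invr_ge0 ltW.
- move=> [_ Kx]; apply/(extremal_integral_max_indic E_T2 n UP (SMX w) cK xV0 ler01).
  move=> i /Kx; have /fineK <- := supmeasure_fin_num (SMX w) (cK i).
  by rewrite -EFinM !lee_fin mulrC ler_pdivrMr// mul1r.
- by rewrite invr_ge0 ltW.
- move=> /(extremal_integral_max_indic E_T2 n UP (SMX w) cK xV0 ler01) Kx.
  split => // i /Kx; have /fineK <- := supmeasure_fin_num (SMX w) (cK i).
  by rewrite -EFinM !lee_fin mulrC ler_pdivrMr// mul1r.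
Qed.

(** By the pi-lambda theorem it suffices to compare the laws on cylinders, which are stable under
    intersection. *)
Lemma max_stable_law_eq : (forall f, USC f -> tdf P1 X1 f = tdf P2 X2 f) ->
  forall A, supvague_borel A -> P1 (X1 @^-1` A) = P2 (X2 @^-1` A).
Proof.
move=> tdf12.
have SM1 := max_stable_SM ms1; have SM2 := max_stable_SM ms2.
pose H : set (set (set E -> \bar R)) := [set A | [/\ A `<=` SM,
  measurable (X1 @^-1` A), measurable (X2 @^-1` A) &
  P1 (X1 @^-1` A) = P2 (X2 @^-1` A)]].
have P1fin B : measurable B -> (P1 B < +oo)%E.
  by move=> mB; rewrite (le_lt_trans (probability_le1 _ _))// ltry.
have P2fin B : measurable B -> (P2 B < +oo)%E.
  by move=> mB; rewrite (le_lt_trans (probability_le1 _ _))// ltry.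
have HL : lambda_system SM H.
  split.
  - by move=> A [].
  - have T1 : X1 @^-1` SM = setT by apply/seteqP; split => // w _ /=.
    have T2 : X2 @^-1` SM = setT by apply/seteqP; split => // w _ /=.
    rewrite /H/= T1 T2; split; [by []|exact: measurableT|exact: measurableT|].
    by rewrite !probability_setT.
  - move=> A B BA [AS mA1 mA2 PA] [BS mB1 mB2 PB].
    have preD T (X : T -> set E -> \bar R) :
      X @^-1` (A `\` B) = X @^-1` A `\` X @^-1` B by [].
    rewrite /H/= !preD; split.
    + by apply: subset_trans AS; exact: subDsetl.
    + exact: measurableD.
    + exact: measurableD.
    + have BA1 : X1 @^-1` B `<=` X1 @^-1` A by move=> w; exact: BA.
      have BA2 : X2 @^-1` B `<=` X2 @^-1` A by move=> w; exact: BA.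
      rewrite !measureD//; [|exact: P2fin|exact: P1fin].
      by rewrite (setIidr BA1) (setIidr BA2); congr (_ - _)%E.
  - move=> F ndF HF; rewrite /H/= !preimage_bigcup.
    have mF1 i : measurable (X1 @^-1` F i) by case: (HF i).
    have mF2 i : measurable (X2 @^-1` F i) by case: (HF i).
    split; [by apply: bigcup_sub => i _; case: (HF i)|exact: bigcupT_measurable|
      exact: bigcupT_measurable|].
    have c1 : P1 \o (fun i => X1 @^-1` F i) @ \oo --> P1 (\bigcup_i X1 @^-1` F i).
      apply: nondecreasing_cvg_mu => //; first exact: bigcupT_measurable.
      by move=> i j /ndF/subsetPset Fij; apply/subsetPset => w; exact: Fij.
    have c2 : P2 \o (fun i => X2 @^-1` F i) @ \oo --> P2 (\bigcup_i X2 @^-1` F i).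
      apply: nondecreasing_cvg_mu => //; first exact: bigcupT_measurable.
      by move=> i j /ndF/subsetPset Fij; apply/subsetPset => w; exact: Fij.
    apply: (cvg_unique _ c1); first exact: ereal_hausdorff.
    rewrite (_ : P1 \o _ = P2 \o (fun i => X2 @^-1` F i))//.
    by apply/funext => i /=; case: (HF i).
have sH : sigma `<=` H.
  apply: (lambda_system_subset cylinders_setI HL) => [A|A].
    move=> [n [K [x [cK x0 ->]]]]; have xV0 i : 0 <= (x i)^-1 by rewrite invr_ge0 ltW.
    have Um := USC_max_indic E_T2 n cK xV0.
    rewrite /H/= !preimage_cylinder//; split.
    - by move=> phi [].
    - exact: (measurable_extremal_integral ms1 Um ltr01).
    - exact: (measurable_extremal_integral ms2 Um ltr01).
    (* Both probabilities are values at 1 of a Fréchet distribution function whose scale is the tail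
       dependence of the same [max_indic]. *)
    - have [_ ->//] := tdf_scale ms1 Um; have [_ ->//] := tdf_scale ms2 Um.
      by rewrite tdf12.
  exact: sigma_sub_SM.
move=> A bA; have [] : H A; last by [].
apply: sH; apply: (smallest_sub (smallest_sigma_algebra SM cylinders)) bA.
exact: supvague_open_sigma.
Qed.

End law.
End uniqueness.

Theorem mainTheorem5 (R : realType) (E : topologicalType)
  (E_lc : locally_compact [set: E]) (E_T2 : hausdorff_space E)
  (E_2c : @second_countable E) :
  (forall (d : measure_display) (Omega : measurableType d)
          (P : probability Omega R) (X : Omega -> set E -> \bar R),
     max_stable P X ->
     (CRSM P X <->
      forall f : E -> R, USC f ->
        (tdf P X f)%:E = choquet_integral (ecf P X) f)) /\
  (forall (d1 d2 : measure_display)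
          (Omega1 : measurableType d1) (Omega2 : measurableType d2)
          (P1 : probability Omega1 R) (P2 : probability Omega2 R)
          (X1 : Omega1 -> set E -> \bar R) (X2 : Omega2 -> set E -> \bar R),
     CRSM P1 X1 -> CRSM P2 X2 ->
     (forall K : set E, compact K -> ecf P1 X1 K = ecf P2 X2 K) ->
     forall A, supvague_borel A -> P1 (X1 @^-1` A) = P2 (X2 @^-1` A)).
Proof.
split=> [d Omega P X msX|d1 d2 Omega1 Omega2 P1 P2 X1 X2 [ms1 add1] [ms2 add2] ecf12].
  split=> [[_ add] f|tdfE]; first exact: tdf_choquet.
  by split => // f g Uf Ug fg; exact: choquet_tdfD.
have [U UP] := exists_compact_neighbourhoods E_lc E_T2 E_2c.
apply: (max_stable_law_eq E_T2 UP ms1 ms2) => f Uf; apply: EFin_inj.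
(* The Choquet integral involves only levels [t > 0], whose level sets are compact, and there the
   two extremal coefficient functionals agree. *)
rewrite !tdf_choquet//; apply: eq_integral => t; rewrite inE/= in_itv/= andbT => t0.
by rewrite -level_gt0// ecf12//; exact: compact_level.
Qed.
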